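(* Let $M$ be a non-minimal meridian surface of type $\mathcal{M}'_a$, i.e. $z(u,v)=f(u)\,l(v)+g(u)\,e_4$ with $l$ a spacelike unit-speed curve on $\mathbb{S}^2_1(1)\subset \mathrm{span}\{e_1,e_2,e_3\}$ (respectively, of type $\widetilde{\mathcal{M}}''_b$, i.e. $z(u,v)=g(u)\,e_1+f(u)\,l(v)$ with $l$ a timelike unit-speed curve on $\mathbb{H}^2_1(-1)\subset \mathrm{span}\{e_2,e_3,e_4\}$), where $f'^2-g'^2=-1$. Then $M$ has parallel mean curvature vector field if and only if one of the following cases holds: (i) the curve $l$ has constant spherical curvature and the meridian is defined by $f(u)=a$, $g(u)=\pm u+b$, where $a=\mathrm{const}\neq 0$, $b=\mathrm{const}$. In this case $M$ is a flat CMC-surface. (ii) the curve $l$ has zero spherical curvature and the meridian is determined by $f'=\varphi(f)$, where $$\varphi(t)=\pm\frac{1}{t}\sqrt{(c\pm a\,t^2)^2-t^2},\qquad a=\mathrm{const}\neq 0,\quad c=\mathrm{const},$$ and $g$ is defined by $g'=\sqrt{f'^2+1}$. In this case $M$ lies in a hyperplane of $\mathbb{E}^4_2$.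
   Context: Ambient space: $\mathbb{E}^4_2$ is $\mathbb{R}^4$ with the metric $\langle\cdot,\cdot\rangle=dx_1^2+dx_2^2-dx_3^2-dx_4^2$; $e_1,e_2,e_3,e_4$ is an orthonormal basis with $\langle e_1,e_1\rangle=\langle e_2,e_2\rangle=1$, $\langle e_3,e_3\rangle=\langle e_4,e_4\rangle=-1$. A vector $v$ is spacelike if $\langle v,v\rangle>0$ or $v=0$, timelike if $\langle v,v\rangle<0$. Meridian surfaces: $f,g$ are smooth real functions on an interval $I$, $f$ nowhere zero; $l$ is a smooth curve on an interval $J$; $u\in I$, $v\in J$. The curve $u\mapsto(f(u),g(u))$ is called the meridian. Type $\mathcal{M}'_a$: $z(u,v)=f(u)l(v)+g(u)e_4$, where $l(v)=\cosh w^1\cos w^2\,e_1+\cosh w^1\sin w^2\,e_2+\sinh w^1\,e_3$ with $w^1=w^1(v)$, $w^2=w^2(v)$ smooth, a curve on $\mathbb{S}^2_1(1)=\{V\in\mathrm{span}\{e_1,e_2,e_3\}:\langle V,V\rangle=1\}$ with $\langle l',l'\rangle=1$, and $f'^2-g'^2=-1$. The first fundamental form is $E=-1$, $F=0$, $G=f^2$. Type $\widetilde{\mathcal{M}}''_b$: $z(u,v)=g(u)e_1+f(u)l(v)$, where $l(v)=\sinh w^1\,e_2+\cosh w^1\cos w^2\,e_3+\cosh w^1\sin w^2\,e_4$ with $w^1,w^2$ smooth functions of $v$, a curve on $\mathbb{H}^2_1(-1)=\{V\in\mathrm{span}\{e_2,e_3,e_4\}:\langle V,V\rangle=-1\}$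 with $\langle l',l'\rangle=-1$, and $f'^2-g'^2=-1$. The first fundamental form is $E=1$, $F=0$, $G=-f^2$. Both are Lorentz surfaces (induced metric of signature $(1,1)$). Spherical curvature: let $t=l'$ and let $n(v)$ be the vector field, unique up to sign, in the 3-dimensional space containing $l$, such that $\{l,t,n\}$ is an orthonormal frame. The spherical curvature of $l$ is $\kappa(v)=\langle t'(v),n(v)\rangle$. Mean curvature: $h$ is the second fundamental form, $H=\tfrac12\,\mathrm{tr}\,h$ is the mean curvature vector field, $D$ is the normal connection. The surface is minimal if $H\equiv 0$; it has parallel mean curvature vector field if $DH=0$ identically. ''CMC'' means that $\langle H,H\rangle$ is constant (possibly zero); ''flat'' means that the Gauss curvature vanishes identically.
   Formalization: In (ii) the outer sign of φ may vary with u (f=cosh u, g=sinh u, zero spherical curvature, has f' changing sign), and g'=±√(f'²+1) with one global sign is allowed (f=cosh u, g=−sinh u is also parallel); the radicand is required to be nonnegative. *)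

(* Defs.v *)
From Stdlib Require Import Reals.
From Coquelicot Require Import Coquelicot.
Local Open Scope R_scope.

(** * The pseudo-Euclidean space E^4_2 *)

(** Linear operations are Coquelicot's [plus], [scal], [zero], ... on the product module. *)
Definition E42 : Type := (R * R * R * R)%type.

Definition cmp1 (x : E42) : R := fst (fst (fst x)).
Definition cmp2 (x : E42) : R := snd (fst (fst x)).
Definition cmp3 (x : E42) : R := snd (fst x).
Definition cmp4 (x : E42) : R := snd x.

Definition inner (x y : E42) : R :=
  cmp1 x * cmp1 y + cmp2 x * cmp2 y - cmp3 x * cmp3 y - cmp4 x * cmp4 y.

Definition e1 : E42 := (1, 0, 0, 0).
Definition e2 : E42 := (0, 1, 0, 0).
Definition e3 : E42 := (0, 0, 1, 0).
Definition e4 : E42 := (0, 0, 0, 1).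

Definition vadd (x y : E42) : E42 := plus x y.
Definition vsub (x y : E42) : E42 := minus x y.
Definition vscal (a : R) (x : E42) : E42 := scal a x.
Definition vzero : E42 := zero.

(** * Smoothness *)

Definition is_open_interval (I : R -> Prop) : Prop :=
  open I /\ forall x y w, I x -> I y -> x <= w <= y -> I w.

(** C^infinity on an open set [I]; the values outside [I] are irrelevant. *)
Definition smooth_on (I : R -> Prop) (f : R -> R) : Prop :=
  forall k x, I x -> ex_derive_n f k x.

Definition vsmooth_on (I : R -> Prop) (c : R -> E42) : Prop :=
  smooth_on I (fun s => cmp1 (c s)) /\ smooth_on I (fun s => cmp2 (c s)) /\
  smooth_on I (fun s => cmp3 (c s)) /\ smooth_on I (fun s => cmp4 (c s)).

Definition vDerive (c : R -> E42) (s : R) : E42 :=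
  (Derive (fun r => cmp1 (c r)) s, Derive (fun r => cmp2 (c r)) s,
   Derive (fun r => cmp3 (c r)) s, Derive (fun r => cmp4 (c r)) s).

(** * Parametrized surfaces and vector fields along them *)

Definition vfield : Type := R -> R -> E42.

Definition d_u (W : vfield) : vfield := fun u v => vDerive (fun s => W s v) u.
Definition d_v (W : vfield) : vfield := fun u v => vDerive (fun s => W u s) v.

Section Surface.
Variable z : vfield.

Definition coefE (u v : R) : R := inner (d_u z u v) (d_u z u v).
Definition coefF (u v : R) : R := inner (d_u z u v) (d_v z u v).
Definition coefG (u v : R) : R := inner (d_v z u v) (d_v z u v).
Definition metric_det (u v : R) : R := coefE u v * coefG u v - coefF u v ^ 2.

(** Orthogonal projections onto the tangent and the normal plane,
    meaningful where [metric_det] does not vanish. *)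
Definition tangential (W : vfield) : vfield := fun u v =>
  let p := inner (W u v) (d_u z u v) in
  let q := inner (W u v) (d_v z u v) in
  vadd
    (vscal ((coefG u v * p - coefF u v * q) / metric_det u v) (d_u z u v))
    (vscal ((coefE u v * q - coefF u v * p) / metric_det u v) (d_v z u v)).

Definition normal_part (W : vfield) : vfield := fun u v =>
  vsub (W u v) (tangential W u v).

(** Levi-Civita connection of the induced metric, on tangent fields. *)
Definition nabla_u (W : vfield) : vfield := tangential (d_u W).
Definition nabla_v (W : vfield) : vfield := tangential (d_v W).

(** Normal connection, on normal fields. *)
Definition D_u (W : vfield) : vfield := normal_part (d_u W).
Definition D_v (W : vfield) : vfield := normal_part (d_v W).

(** Second fundamental form on the coordinate fields. *)
Definition h_uu : vfield := normal_part (d_u (d_u z)).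
Definition h_uv : vfield := normal_part (d_u (d_v z)).
Definition h_vv : vfield := normal_part (d_v (d_v z)).

(** H = (1/2) g^{ij} h_{ij}. *)
Definition mean_curvature : vfield := fun u v =>
  vscal (/ 2 * / metric_det u v)
    (vadd (vsub (vscal (coefG u v) (h_uu u v))
                (vscal (2 * coefF u v) (h_uv u v)))
          (vscal (coefE u v) (h_vv u v))).

(** K = <R(z_u,z_v)z_v, z_u> / (EG - F^2), R being the curvature of the
    Levi-Civita connection. *)
Definition gauss_curvature (u v : R) : R :=
  inner (vsub (nabla_u (nabla_v (d_v z)) u v) (nabla_v (nabla_u (d_v z)) u v))
        (d_u z u v) / metric_det u v.

Variables I J : R -> Prop.

Definition minimal : Prop :=
  forall u v, I u -> J v -> mean_curvature u v = vzero.

Definition parallel_mean_curvature : Prop :=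
  forall u v, I u -> J v ->
    D_u mean_curvature u v = vzero /\ D_v mean_curvature u v = vzero.

Definition CMC : Prop :=
  exists k : R, forall u v, I u -> J v ->
    inner (mean_curvature u v) (mean_curvature u v) = k.

Definition flat : Prop :=
  forall u v, I u -> J v -> gauss_curvature u v = 0.

Definition in_hyperplane : Prop :=
  exists (N : E42) (d : R), N <> vzero /\
    forall u v, I u -> J v -> inner (z u v) N = d.

End Surface.

(** * Meridian surfaces *)

(** [Ma] stands for M'_a and [Mb] for \tilde M''_b. *)
Inductive meridian_type : Set := Ma | Mb.

Definition base_curve (ty : meridian_type) (w1 w2 : R -> R) (v : R) : E42 :=
  match ty with
  | Ma => (cosh (w1 v) * cos (w2 v), cosh (w1 v) * sin (w2 v), sinh (w1 v), 0)
  | Mb => (0, sinh (w1 v), cosh (w1 v) * cos (w2 v), cosh (w1 v) * sin (w2 v))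
  end.

(** Common value of <l,l> and <l',l'>. *)
Definition base_sign (ty : meridian_type) : R :=
  match ty with Ma => 1 | Mb => -1 end.

(** span{e1,e2,e3}, respectively span{e2,e3,e4}. *)
Definition base_space (ty : meridian_type) (x : E42) : Prop :=
  match ty with Ma => cmp4 x = 0 | Mb => cmp1 x = 0 end.

Definition meridian_surface (ty : meridian_type) (f g : R -> R) (l : R -> E42) : vfield :=
  fun u v =>
    match ty with
    | Ma => vadd (vscal (f u) (l v)) (vscal (g u) e4)
    | Mb => vadd (vscal (g u) e1) (vscal (f u) (l v))
    end.

Definition is_sign (s : R) : Prop := s = 1 \/ s = -1.

Definition orthonormal3 (x y w : E42) : Prop :=
  is_sign (inner x x) /\ is_sign (inner y y) /\ is_sign (inner w w) /\
  inner x y = 0 /\ inner x w = 0 /\ inner y w = 0.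

Definition frame_normal (ty : meridian_type) (J : R -> Prop) (l n : R -> E42) : Prop :=
  vsmooth_on J n /\
  forall v, J v -> base_space ty (n v) /\ orthonormal3 (l v) (vDerive l v) (n v).

Definition spherical_curvature (l n : R -> E42) (v : R) : R :=
  inner (vDerive (vDerive l) v) (n v).

(** * The two cases of the classification *)

Definition case_i (I J : R -> Prop) (f g kappa : R -> R) : Prop :=
  (exists k : R, forall v, J v -> kappa v = k) /\
  exists a b s : R, a <> 0 /\ is_sign s /\
    forall u, I u -> f u = a /\ g u = s * u + b.

Definition radicand (s a c t : R) : R := (c + s * a * t ^ 2) ^ 2 - t ^ 2.

Definition phi (s0 s a c t : R) : R := s0 * (1 / t) * sqrt (radicand s a c t).

(** The outer sign [s0] of phi may change along the meridian, which happens at the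
    zeros of f' (for instance f = cosh, g = sinh, with a = 1 and c = 0).  The sign
    [sg] reflects the fact that f'^2 - g'^2 = -1 determines g' only up to a constant
    sign; reversing the parameter u reduces [sg = -1] to [sg = 1].  As [sqrt] is
    total, the nonnegativity of the radicand has to be stated. *)
Definition case_ii (I J : R -> Prop) (f g kappa : R -> R) : Prop :=
  (forall v, J v -> kappa v = 0) /\
  exists a c s sg : R, a <> 0 /\ is_sign s /\ is_sign sg /\
    (forall u, I u -> 0 <= radicand s a c (f u) /\
       exists s0, is_sign s0 /\ Derive f u = phi s0 s a c (f u)) /\
    (forall u, I u -> Derive g u = sg * sqrt (Derive f u ^ 2 + 1)).

(* Main.v *)
Require Import Defs.
From Stdlib Require Import Reals Lra Classical Ranalysis5.
From Coquelicot Require Import Coquelicot.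
Local Open Scope R_scope.


(** Both types of surface are treated at once.  Put eps = <l,l> and let e be the
    axis, e4 or e1; counting signs in the metric, <l',l'> = eps and
    <n,n> = <e,e> = - eps.  In the frame l, t = l', n, e one has
      l' = t,   t' = - l - eps kappa n,   n' = - eps kappa t   ([base_curve_moving_frame]),
    and z = f l + g e.  Every field that occurs is a combination of the frame whose
    coefficients are explicit functions of u and v, so all covariant computations
    reduce to differentiating coefficients.

    The normal plane is spanned by n and n2 = g' l + f' e, and both are parallel for
    the normal connection.  The result of the computation is
      - 2 H = (kappa / f) n + eps B n2,   B = g' f'' - f' g'' + g' / f
    ([mean_curvature_frame]).  Hence DH = 0 means that B is constant in u, kappa is
    constant in v, and kappa f' = 0 ([parallel_mean_curvature_frame]).

    If kappa <> 0 somewhere, then f' = 0, so f is constant and g' = 1 or g' = -1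
    throughout: this is case (i).  If kappa vanishes identically, what remains is the
    equation B = 2 a, where a <> 0 because H is not identically zero.  By
    f' f'' = g' g'' one has (f g')' = f f' B, so the equation integrates to
    f g' = c + a f^2; squaring and using g'^2 = 1 + f'^2 gives the equation for f' of
    case (ii).

    Conversely, case (i) makes B and kappa constant at once.  In case (ii), putting
    p = a or p = - a, one recovers (f g')^2 = (c + p f^2)^2, and differentiating it
    only gives f' (B^2 - 4 p^2) = 0.  The zeros of f', which may fill an interval,
    have to be dealt with: [first_integral_meridian_trace1] shows that B' vanishes all
    the same.

    When f' = 0 the tangential parts of z_vv and z_uv vanish, whence flatness; when
    kappa = 0 the vector n is constant and orthogonal to z, whence a hyperplane. *)

(** * Calculus on an open interval *)

Lemma is_derive_eq (F : R -> R) (x a b : R) : is_derive F x a -> a = b -> is_derive F x b.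
Proof. now intros H <-. Qed.

Lemma is_derive_mul (F G : R -> R) (x a b : R) :
  is_derive F x a -> is_derive G x b -> is_derive (fun y => F y * G y) x (a * G x + F x * b).
Proof. intros HF HG; apply (is_derive_mult F G x a b HF HG); exact Rmult_comm. Qed.

Lemma is_derive_sum4 (F1 F2 F3 F4 : R -> R) (x a1 a2 a3 a4 : R) :
  is_derive F1 x a1 -> is_derive F2 x a2 -> is_derive F3 x a3 -> is_derive F4 x a4 ->
  is_derive (fun y => F1 y + F2 y + F3 y + F4 y) x (a1 + a2 + a3 + a4).
Proof.
intros; repeat apply @is_derive_plus; assumption.
Qed.

(** How an identity valid on an open set is differentiated. *)
Lemma is_derive_eq_on_open (I : R -> Prop) (F G : R -> R) (x a b : R) :
  open I -> I x -> (forall y, I y -> F y = G y) ->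
  is_derive F x a -> is_derive G x b -> a = b.
Proof.
intros HI Hx HFG HF HG.
rewrite <- (is_derive_unique _ _ _ HF), <- (is_derive_unique _ _ _ HG).
apply Derive_ext_loc; apply filter_imp with I; [exact HFG | exact (HI x Hx)].
Qed.

Lemma constant_of_derive_0 (I : R -> Prop) (F : R -> R) :
  is_open_interval I -> (forall x, I x -> is_derive F x 0) ->
  forall x y, I x -> I y -> F x = F y.
Proof.
intros [_ HI] HF x y Hx Hy.
assert (Hin : forall w, Rmin x y <= w <= Rmax x y -> I w).
{ intros w Hw; unfold Rmin, Rmax in Hw; destruct (Rle_dec x y).
  - now apply (HI x y).
  - now apply (HI y x). }
destruct (MVT_gen F x y (fun _ => 0)) as [c [_ Hc]].
- intros w Hw; apply HF, Hin; lra.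
- intros w Hw; apply continuity_pt_filterlim.
  apply (ex_derive_continuous F w); exists 0; apply HF, Hin, Hw.
- lra.
Qed.

Lemma constant_sign (I : R -> Prop) (F : R -> R) :
  is_open_interval I -> (forall x, I x -> continuous F x) ->
  (forall x, I x -> F x <> 0) ->
  exists s, is_sign s /\ forall x, I x -> 0 < s * F x.
Proof.
intros [_ HI] HF H0.
assert (Hbad : forall (G : R -> R) x y, I x -> I y -> x < y ->
  (forall w, I w -> continuous G w) -> (forall w, I w -> G w <> 0) ->
  G x < 0 -> 0 < G y -> False).
{ intros G x y Hx Hy Hxy HG HG0 Gx Gy.
  destruct (IVT_interv G x y) as [w [Hw Gw]]; try assumption.
  - intros w Hw; apply continuity_pt_filterlim, HG, (HI x y); assumption.
  - apply (HG0 w); [now apply (HI x y) | exact Gw]. }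
assert (Hsame : forall x y, I x -> I y -> F x < 0 -> 0 < F y -> False).
{ intros x y Hx Hy Fx Fy; destruct (Rtotal_order x y) as [Hxy | [-> | Hxy]].
  - now apply (Hbad F x y).
  - lra.
  - apply (Hbad (fun w => - F w) y x); try assumption; try lra.
    + intros w Hw; apply (continuous_opp F w), HF, Hw.
    + intros w Hw; specialize (H0 w Hw); lra. }
destruct (classic (exists x, I x /\ F x < 0)) as [[x [Hx Fx]] | Hpos].
- exists (-1); split; [now right |].
  intros y Hy; destruct (Rtotal_order (F y) 0) as [Fy | [Fy | Fy]].
  + lra.
  + now destruct (H0 y Hy).
  + destruct (Hsame x y Hx Hy Fx Fy).
- exists 1; split; [now left |].
  intros y Hy; destruct (Rtotal_order (F y) 0) as [Fy | [Fy | Fy]].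
  + destruct Hpos; now exists y.
  + now destruct (H0 y Hy).
  + lra.
Qed.

Definition twice_differentiable_on (J : R -> Prop) (F : R -> R) : Prop :=
  forall x, J x -> ex_derive F x /\ ex_derive (Derive F) x.

(** [Derive] is known near a point from any pointwise formula valid on an open set,
    which is what makes its own differentiability accessible. *)
Lemma twice_differentiable_ext (J : R -> Prop) (F F1 : R -> R) :
  open J -> (forall x, J x -> is_derive F x (F1 x)) ->
  (forall x, J x -> ex_derive F1 x) -> twice_differentiable_on J F.
Proof.
intros HJ HF HF1 x Hx; split; [now exists (F1 x); apply HF |].
apply ex_derive_ext_loc with F1; [| now apply HF1].
apply filter_imp with J; [| exact (HJ x Hx)].
intros y Hy; symmetry; apply is_derive_unique, HF, Hy.
Qed.

Lemma twice_differentiable_mult (J : R -> Prop) (F G : R -> R) :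
  open J -> twice_differentiable_on J F -> twice_differentiable_on J G ->
  twice_differentiable_on J (fun x => F x * G x).
Proof.
intros HJ HF HG.
apply twice_differentiable_ext with (fun x => Derive F x * G x + F x * Derive G x).
- exact HJ.
- intros x Hx; destruct (HF x Hx) as [HF1 _], (HG x Hx) as [HG1 _].
  auto_derive; [now split |].
  change (fun y => F y) with F; change (fun y => G y) with G; ring.
- intros x Hx; destruct (HF x Hx), (HG x Hx).
  auto_derive; repeat split; assumption.
Qed.

Lemma twice_differentiable_comp (J : R -> Prop) (P P1 w : R -> R) :
  open J -> (forall x, is_derive P x (P1 x)) -> (forall x, ex_derive P1 x) ->
  twice_differentiable_on J w -> twice_differentiable_on J (fun x => P (w x)).
Proof.
intros HJ HP HP1 Hw.
apply twice_differentiable_ext with (fun x => Derive w x * P1 (w x)).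
- exact HJ.
- intros x Hx; apply (is_derive_comp P w); [apply HP | apply Derive_correct, Hw, Hx].
- intros x Hx; destruct (Hw x Hx).
  apply @ex_derive_mult; [assumption | now apply @ex_derive_comp].
Qed.

Lemma is_derive_cosh (x : R) : is_derive cosh x (sinh x).
Proof. apply is_derive_Reals, derivable_pt_lim_cosh. Qed.

Lemma is_derive_sinh (x : R) : is_derive sinh x (cosh x).
Proof. apply is_derive_Reals, derivable_pt_lim_sinh. Qed.

Lemma smooth_twice_differentiable (J : R -> Prop) (F : R -> R) :
  smooth_on J F -> twice_differentiable_on J F.
Proof. intros HF x Hx; split; [apply (HF 1%nat x Hx) | apply (HF 2%nat x Hx)]. Qed.

(** * Vectors in components *)

Lemma E42_ext (x y : E42) :
  cmp1 x = cmp1 y -> cmp2 x = cmp2 y -> cmp3 x = cmp3 y -> cmp4 x = cmp4 y -> x = y.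
Proof.
destruct x as [[[x1 x2] x3] x4], y as [[[y1 y2] y3] y4]; unfold cmp1, cmp2, cmp3, cmp4; simpl.
now intros -> -> -> ->.
Qed.

Definition is_vderive (c : R -> E42) (s : R) (w : E42) : Prop :=
  is_derive (fun r => cmp1 (c r)) s (cmp1 w) /\ is_derive (fun r => cmp2 (c r)) s (cmp2 w) /\
  is_derive (fun r => cmp3 (c r)) s (cmp3 w) /\ is_derive (fun r => cmp4 (c r)) s (cmp4 w).

Lemma is_vderive_unique (c : R -> E42) (s : R) (w : E42) : is_vderive c s w -> vDerive c s = w.
Proof.
intros (H1 & H2 & H3 & H4); apply E42_ext; now apply is_derive_unique.
Qed.

Lemma vDerive_correct (c : R -> E42) (s : R) :
  ex_derive (fun r => cmp1 (c r)) s -> ex_derive (fun r => cmp2 (c r)) s ->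
  ex_derive (fun r => cmp3 (c r)) s -> ex_derive (fun r => cmp4 (c r)) s ->
  is_vderive c s (vDerive c s).
Proof. intros; refine (conj _ (conj _ (conj _ _))); now apply Derive_correct. Qed.

Lemma vDerive_ext_on (J : R -> Prop) (c d : R -> E42) (s : R) :
  open J -> J s -> (forall r, J r -> c r = d r) -> vDerive c s = vDerive d s.
Proof.
intros HJ Hs Hcd.
assert (Hloc : locally s (fun r => c r = d r)) by (apply filter_imp with J; [exact Hcd | exact (HJ s Hs)]).
apply E42_ext; apply Derive_ext_loc; revert Hloc; apply filter_imp; now intros r ->.
Qed.

Lemma is_derive_inner (c d : R -> E42) (s : R) (x y : E42) :
  is_vderive c s x -> is_vderive d s y ->
  is_derive (fun r => inner (c r) (d r)) s (inner x (d s) + inner (c s) y).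
Proof.
intros (C1 & C2 & C3 & C4) (D1 & D2 & D3 & D4); unfold inner.
eapply is_derive_eq.
- apply @is_derive_minus; [apply @is_derive_minus; [apply @is_derive_plus |] |];
    (eapply is_derive_mul; [eassumption | eassumption]).
- unfold minus, plus, opp; simpl; ring.
Qed.

Lemma inner_sym (x y : E42) : inner x y = inner y x.
Proof. unfold inner; ring. Qed.

(** * The moving frame *)

(** a x + b y + c w + d e, spelled out so that components reduce by computation. *)
Definition comb (x y w e : E42) (a b c d : R) : E42 :=
  (a * cmp1 x + b * cmp1 y + c * cmp1 w + d * cmp1 e,
   a * cmp2 x + b * cmp2 y + c * cmp2 w + d * cmp2 e,
   a * cmp3 x + b * cmp3 y + c * cmp3 w + d * cmp3 e,
   a * cmp4 x + b * cmp4 y + c * cmp4 w + d * cmp4 e).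

(** The orthonormal frame and its structure equations, with <l,l> = eps; every
    computation on the surface uses only these, and so covers both types. *)
Record moving_frame (eps : R) (J : R -> Prop) (kappa : R -> R) (l t n : R -> E42) (e : E42) : Prop := {
  mf_open : open J;
  mf_eps : is_sign eps;
  mf_ll : forall v, J v -> inner (l v) (l v) = eps;
  mf_tt : forall v, J v -> inner (t v) (t v) = eps;
  mf_nn : forall v, J v -> inner (n v) (n v) = - eps;
  mf_ee : inner e e = - eps;
  mf_lt : forall v, J v -> inner (l v) (t v) = 0;
  mf_ln : forall v, J v -> inner (l v) (n v) = 0;
  mf_tn : forall v, J v -> inner (t v) (n v) = 0;
  mf_le : forall v, J v -> inner (l v) e = 0;
  mf_te : forall v, J v -> inner (t v) e = 0;
  mf_ne : forall v, J v -> inner (n v) e = 0;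
  mf_dl : forall v, J v -> is_vderive l v (t v);
  mf_dt : forall v, J v -> is_vderive t v (comb (l v) (t v) (n v) e (-1) 0 (- eps * kappa v) 0);
  mf_dn : forall v, J v -> is_vderive n v (comb (l v) (t v) (n v) e 0 (- eps * kappa v) 0 0) }.

Arguments mf_open {eps J kappa l t n e}.
Arguments mf_eps {eps J kappa l t n e}.
Arguments mf_ll {eps J kappa l t n e}.
Arguments mf_tt {eps J kappa l t n e}.
Arguments mf_nn {eps J kappa l t n e}.
Arguments mf_ee {eps J kappa l t n e}.
Arguments mf_lt {eps J kappa l t n e}.
Arguments mf_ln {eps J kappa l t n e}.
Arguments mf_tn {eps J kappa l t n e}.
Arguments mf_le {eps J kappa l t n e}.
Arguments mf_te {eps J kappa l t n e}.
Arguments mf_ne {eps J kappa l t n e}.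
Arguments mf_dl {eps J kappa l t n e}.
Arguments mf_dt {eps J kappa l t n e}.
Arguments mf_dn {eps J kappa l t n e}.

Section FrameCalculus.
Context {eps : R} {J : R -> Prop} {kappa : R -> R} {l t n : R -> E42} {e : E42}.
Context (MF : moving_frame eps J kappa l t n e).

Definition frame_vec (v a b c d : R) : E42 := comb (l v) (t v) (n v) e a b c d.

Lemma inner_frame_vec v a b c d a' b' c' d' : J v ->
  inner (frame_vec v a b c d) (frame_vec v a' b' c' d') = eps * (a * a' + b * b' - c * c' - d * d').
Proof.
intros Hv.
transitivity (a * a' * inner (l v) (l v) + b * b' * inner (t v) (t v) + c * c' * inner (n v) (n v)
  + d * d' * inner e e + (a * b' + b * a') * inner (l v) (t v) + (a * c' + c * a') * inner (l v) (n v)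
  + (b * c' + c * b') * inner (t v) (n v) + (a * d' + d * a') * inner (l v) e
  + (b * d' + d * b') * inner (t v) e + (c * d' + d * c') * inner (n v) e).
- unfold frame_vec, comb, inner, cmp1, cmp2, cmp3, cmp4; simpl; ring.
- rewrite (mf_ll MF v Hv), (mf_tt MF v Hv), (mf_nn MF v Hv),
    (mf_ee MF), (mf_lt MF v Hv), (mf_ln MF v Hv),
    (mf_tn MF v Hv), (mf_le MF v Hv), (mf_te MF v Hv),
    (mf_ne MF v Hv); ring.
Qed.

Lemma eps_sqr : eps * eps = 1.
Proof. destruct (mf_eps MF) as [-> | ->]; ring. Qed.

Lemma frame_vec_eq v a b c d a' b' c' d' :
  a = a' -> b = b' -> c = c' -> d = d' -> frame_vec v a b c d = frame_vec v a' b' c' d'.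
Proof. now intros -> -> -> ->. Qed.

Lemma frame_vec_0 v : frame_vec v 0 0 0 0 = vzero.
Proof.
apply E42_ext; unfold frame_vec, comb, cmp1, cmp2, cmp3, cmp4; simpl; change (@zero R_AbelianMonoid) with 0; ring.
Qed.

Lemma frame_vec_eq_0 v a b c d : J v -> frame_vec v a b c d = vzero -> a = 0 /\ b = 0 /\ c = 0 /\ d = 0.
Proof.
intros Hv H; rewrite <- (frame_vec_0 v) in H.
assert (K : forall a' b' c' d', eps * (a * a' + b * b' - c * c' - d * d') = 0).
{ intros; rewrite <- (inner_frame_vec v) by assumption; rewrite H, inner_frame_vec by assumption; ring. }
pose proof eps_sqr as He.
assert (Hc : forall x, eps * x = 0 -> x = 0).
{ intros x Hx; replace x with (eps * (eps * x)) by (rewrite <- Rmult_assoc, He; ring).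
  rewrite Hx; ring. }
repeat split.
- generalize (Hc _ (K 1 0 0 0)); lra.
- generalize (Hc _ (K 0 1 0 0)); lra.
- generalize (Hc _ (K 0 0 1 0)); lra.
- generalize (Hc _ (K 0 0 0 1)); lra.
Qed.

Lemma frame_vec_add v a b c d a' b' c' d' :
  vadd (frame_vec v a b c d) (frame_vec v a' b' c' d') = frame_vec v (a + a') (b + b') (c + c') (d + d').
Proof.
apply E42_ext; unfold vadd, frame_vec, comb, cmp1, cmp2, cmp3, cmp4; simpl; unfold plus; simpl; ring.
Qed.

Lemma frame_vec_sub v a b c d a' b' c' d' :
  vsub (frame_vec v a b c d) (frame_vec v a' b' c' d') = frame_vec v (a - a') (b - b') (c - c') (d - d').
Proof.
apply E42_ext; unfold vsub, minus, frame_vec, comb, cmp1, cmp2, cmp3, cmp4; simpl; unfold plus, opp; simpl; ring.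
Qed.

Lemma frame_vec_scal v k a b c d : vscal k (frame_vec v a b c d) = frame_vec v (k * a) (k * b) (k * c) (k * d).
Proof.
apply E42_ext; unfold vscal, frame_vec, comb, cmp1, cmp2, cmp3, cmp4; simpl; unfold scal; simpl;
  unfold mult; simpl; ring.
Qed.

Lemma d_u_frame_vec (I : R -> Prop) (W : vfield) (a b c d a' b' c' d' : R -> R -> R) :
  open I ->
  (forall u v, I u -> J v -> W u v = frame_vec v (a u v) (b u v) (c u v) (d u v)) ->
  (forall u v, I u -> J v ->
     is_derive (fun s => a s v) u (a' u v) /\ is_derive (fun s => b s v) u (b' u v) /\
     is_derive (fun s => c s v) u (c' u v) /\ is_derive (fun s => d s v) u (d' u v)) ->
  forall u v, I u -> J v -> d_u W u v = frame_vec v (a' u v) (b' u v) (c' u v) (d' u v).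
Proof.
intros HI HW Hd u v Hu Hv; unfold d_u.
rewrite (vDerive_ext_on I _ (fun s => frame_vec v (a s v) (b s v) (c s v) (d s v)) u HI Hu)
  by (intros; now apply HW).
destruct (Hd u v Hu Hv) as (Ha & Hb & Hc & Hdd).
apply is_vderive_unique; refine (conj _ (conj _ (conj _ _)));
(eapply is_derive_eq;
 [apply is_derive_sum4; (apply is_derive_mul; [eassumption | apply @is_derive_const])
 | unfold frame_vec, comb, cmp1, cmp2, cmp3, cmp4, zero; simpl; ring]).
Qed.

(** Unlike [d_u_frame_vec], the coefficients are mixed by the structure equations. *)
Lemma d_v_frame_vec (I : R -> Prop) (W : vfield) (a b c d a' b' c' d' : R -> R -> R) :
  (forall u v, I u -> J v -> W u v = frame_vec v (a u v) (b u v) (c u v) (d u v)) ->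
  (forall u v, I u -> J v ->
     is_derive (fun s => a u s) v (a' u v) /\ is_derive (fun s => b u s) v (b' u v) /\
     is_derive (fun s => c u s) v (c' u v) /\ is_derive (fun s => d u s) v (d' u v)) ->
  forall u v, I u -> J v ->
    d_v W u v = frame_vec v (a' u v - b u v) (a u v + b' u v - eps * kappa v * c u v)
                     (c' u v - eps * kappa v * b u v) (d' u v).
Proof.
intros HW Hd u v Hu Hv; unfold d_v.
rewrite (vDerive_ext_on J _ (fun s => frame_vec s (a u s) (b u s) (c u s) (d u s)) v (mf_open MF) Hv)
  by (intros; now apply HW).
destruct (Hd u v Hu Hv) as (Ha & Hb & Hc & Hdd).
destruct (mf_dl MF v Hv) as (L1 & L2 & L3 & L4).
destruct (mf_dt MF v Hv) as (T1 & T2 & T3 & T4).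
destruct (mf_dn MF v Hv) as (N1 & N2 & N3 & N4).
apply is_vderive_unique; refine (conj _ (conj _ (conj _ _)));
(eapply is_derive_eq;
 [apply is_derive_sum4; (apply is_derive_mul; [eassumption | eassumption || apply @is_derive_const])
 | unfold frame_vec, comb, cmp1, cmp2, cmp3, cmp4, zero; simpl; ring]).
Qed.

End FrameCalculus.

(** * The meridian curve *)

(** The functions f1, f2, f3 and g1, g2, g3 are successive derivatives on [I]; third
    order is what the derivative of the mean curvature involves. *)
Record meridian (I : R -> Prop) (f f1 f2 f3 g g1 g2 g3 : R -> R) : Prop := {
  me_interval : is_open_interval I;
  me_f : forall u, I u -> is_derive f u (f1 u);
  me_f1 : forall u, I u -> is_derive f1 u (f2 u);
  me_f2 : forall u, I u -> is_derive f2 u (f3 u);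
  me_g : forall u, I u -> is_derive g u (g1 u);
  me_g1 : forall u, I u -> is_derive g1 u (g2 u);
  me_g2 : forall u, I u -> is_derive g2 u (g3 u);
  me_f_neq0 : forall u, I u -> f u <> 0;
  me_unit : forall u, I u -> f1 u ^ 2 - g1 u ^ 2 = -1 }.
Arguments me_interval {I f f1 f2 f3 g g1 g2 g3}.
Arguments me_f {I f f1 f2 f3 g g1 g2 g3}.
Arguments me_f1 {I f f1 f2 f3 g g1 g2 g3}.
Arguments me_f2 {I f f1 f2 f3 g g1 g2 g3}.
Arguments me_g {I f f1 f2 f3 g g1 g2 g3}.
Arguments me_g1 {I f f1 f2 f3 g g1 g2 g3}.
Arguments me_g2 {I f f1 f2 f3 g g1 g2 g3}.
Arguments me_f_neq0 {I f f1 f2 f3 g g1 g2 g3}.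
Arguments me_unit {I f f1 f2 f3 g g1 g2 g3}.

(** Differentiates a rational expression syntactically, taking the derivatives of its
    atoms from the context. *)
Ltac derive_by_rules :=
  match goal with
  | H : is_derive ?F ?x _ |- is_derive ?F ?x _ => exact H
  | |- is_derive (fun y => @?F y + @?G y) _ _ => apply (@is_derive_plus R_AbsRing R_NormedModule F G); derive_by_rules
  | |- is_derive (fun y => @?F y - @?G y) _ _ => apply (@is_derive_minus R_AbsRing R_NormedModule F G); derive_by_rules
  | |- is_derive (fun y => @?F y * @?G y) _ _ => apply (is_derive_mul F G); derive_by_rules
  | |- is_derive (fun y => @?F y / @?G y) _ _ => apply (is_derive_div F G); [derive_by_rules | derive_by_rules | ]
  | |- is_derive (fun y => ?c) _ _ => apply (@is_derive_const R_AbsRing R_NormedModule c)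
  end.

Section Meridian.
Context {I : R -> Prop} {f f1 f2 f3 g g1 g2 g3 : R -> R}.
Context (ME : meridian I f f1 f2 f3 g g1 g2 g3).

(** Up to the factor - eps / 2, the component of H along the normal g' l + f' e: the
    curvature g' f'' - f' g'' of the meridian plus the curvature g' / f of the
    parallels. *)
Definition meridian_trace (u : R) : R := g1 u * f2 u - f1 u * g2 u + g1 u / f u.

(** The derivative of [meridian_trace], after the two terms in f'' g'' have cancelled. *)
Definition meridian_trace1 (u : R) : R :=
  g1 u * f3 u - f1 u * g3 u + (g2 u * f u - g1 u * f1 u) / (f u * f u).

Let HI : open I := proj1 (me_interval ME).

Lemma g1_sqr u : I u -> g1 u * g1 u = 1 + f1 u * f1 u.
Proof. intros Hu; generalize (me_unit ME u Hu); simpl; lra. Qed.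

Lemma g1_neq0 u : I u -> g1 u <> 0.
Proof. intros Hu H; generalize (g1_sqr u Hu); rewrite H; nra. Qed.

(** Derivative of f'^2 - g'^2 = -1. *)
Lemma f1_f2 u : I u -> f1 u * f2 u = g1 u * g2 u.
Proof.
intros Hu.
assert (H : f2 u * f1 u + f1 u * f2 u = g2 u * g1 u + g1 u * g2 u); [| lra].
pose proof (me_f1 ME u Hu); pose proof (me_g1 ME u Hu).
apply (is_derive_eq_on_open I (fun y => f1 y * f1 y) (fun y => g1 y * g1 y - 1) u); try assumption.
- intros y Hy; rewrite (g1_sqr y Hy); ring.
- derive_by_rules.
- eapply is_derive_eq; [derive_by_rules | unfold minus, plus, opp, zero; simpl; ring].
Qed.

Lemma is_derive_meridian_trace u : I u -> is_derive meridian_trace u (meridian_trace1 u).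
Proof.
intros Hu; unfold meridian_trace, meridian_trace1.
pose proof (me_f ME u Hu); pose proof (me_f1 ME u Hu); pose proof (me_f2 ME u Hu).
pose proof (me_g1 ME u Hu); pose proof (me_g2 ME u Hu).
eapply is_derive_eq.
- derive_by_rules; now apply (me_f_neq0 ME).
- unfold minus, plus, opp; simpl; field; now apply (me_f_neq0 ME).
Qed.

(** The left side is (f g')'.  Together with (f^2)' = 2 f f', this is what integrates
    the condition that the trace is constant. *)
Lemma derive_f_g1 u : I u -> f1 u * g1 u + f u * g2 u = f u * f1 u * meridian_trace u.
Proof.
intros Hu; unfold meridian_trace; pose proof (me_f_neq0 ME u Hu) as Hf.
transitivity (f1 u * g1 u + f u * (g1 u * (f1 u * f2 u) - f1 u * f1 u * g2 u)).
- rewrite (f1_f2 u Hu).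
  replace (g1 u * (g1 u * g2 u)) with (g1 u * g1 u * g2 u) by ring.
  rewrite (g1_sqr u Hu); ring.
- field; exact Hf.
Qed.

Lemma meridian_trace_constant_first_integral (a : R) :
  (forall u, I u -> meridian_trace u = 2 * a) ->
  exists c, forall u, I u -> f u * g1 u = c + a * (f u * f u).
Proof.
intros Hb.
destruct (classic (exists u0, I u0)) as [[u0 Hu0] | Hno].
2: { exists 0; intros u Hu; destruct Hno; now exists u. }
exists (f u0 * g1 u0 - a * (f u0 * f u0)); intros u Hu.
assert (H : f u * g1 u - a * (f u * f u) = f u0 * g1 u0 - a * (f u0 * f u0)); [| lra].
apply (constant_of_derive_0 I (fun y => f y * g1 y - a * (f y * f y))); try assumption.
- exact (me_interval ME).
- intros y Hy; pose proof (me_f ME y Hy); pose proof (me_g1 ME y Hy).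
  eapply is_derive_eq; [derive_by_rules |].
  unfold minus, plus, opp, zero; simpl.
  rewrite (derive_f_g1 y Hy), (Hb y Hy); ring.
Qed.

(** Differentiating gives f1 (f g1 B - 2 p (q + p f^2)) = 0 for B the trace; where f1
    does not vanish, squaring and using the first integral again yields B^2 = 4 p^2. *)
Lemma first_integral_meridian_trace_sqr (p q : R) :
  p <> 0 ->
  (forall u, I u -> (f u * g1 u) * (f u * g1 u) = (q + p * (f u * f u)) * (q + p * (f u * f u))) ->
  forall u, I u -> f1 u * (meridian_trace u * meridian_trace u - 4 * (p * p)) = 0.
Proof.
intros Hp HP u Hu.
pose proof (me_f ME u Hu) as D1; pose proof (me_g1 ME u Hu) as D2.
pose proof (me_f_neq0 ME u Hu) as Hf; pose proof (g1_neq0 u Hu) as Hg.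
assert (H : f u * g1 u * (f u * f1 u * meridian_trace u) = (q + p * (f u * f u)) * (2 * p * (f u * f1 u))).
{ rewrite <- (derive_f_g1 u Hu).
  apply Rmult_eq_reg_l with 2; [| lra].
  apply (is_derive_eq_on_open I (fun y => (f y * g1 y) * (f y * g1 y))
    (fun y => (q + p * (f y * f y)) * (q + p * (f y * f y))) u); try assumption;
  (eapply is_derive_eq; [derive_by_rules | unfold plus, zero; simpl; ring]). }
destruct (Req_dec (f1 u) 0) as [-> | Hf1]; [ring |].
assert (H' : f u * g1 u * meridian_trace u = (q + p * (f u * f u)) * (2 * p)).
{ apply Rmult_eq_reg_l with (f u * f1 u); [| now apply Rmult_integral_contrapositive].
  transitivity (f u * g1 u * (f u * f1 u * meridian_trace u)); [ring | rewrite H; ring]. }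
assert (H2 : f u * g1 u * (f u * g1 u) * (meridian_trace u * meridian_trace u - 4 * (p * p)) = 0).
{ transitivity (f u * g1 u * meridian_trace u * (f u * g1 u * meridian_trace u) - 4 * (p * p) * (f u * g1 u * (f u * g1 u))).
  - ring.
  - rewrite H', (HP u Hu); ring. }
apply Rmult_integral in H2; destruct H2 as [H2 | ->]; [exfalso | ring].
revert H2; repeat apply Rmult_integral_contrapositive_currified; assumption.
Qed.

(** Where f is locally constant, the trace is g' / f with g' constant. *)
Lemma meridian_trace1_eq_0_of_f1_locally_0 u : I u -> locally u (fun y => f1 y = 0) -> meridian_trace1 u = 0.
Proof.
intros Hu Hloc.
assert (Hd : forall F F' : R -> R, (forall y, I y -> is_derive F y (F' y)) ->
  locally u (fun y => F y = 0) -> locally u (fun y => F' y = 0)).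
{ intros F F' HF H; apply locally_locally in H.
  generalize (filter_and _ _ H (HI u Hu)); apply filter_imp; intros y [Hy HyI].
  rewrite <- (is_derive_unique _ _ _ (HF y HyI)).
  rewrite (Derive_ext_loc F (fun _ => 0) y Hy); apply Derive_const. }
pose proof (Hd f1 f2 (me_f1 ME) Hloc) as Hloc2.
pose proof (locally_singleton _ _ (Hd f2 f3 (me_f2 ME) Hloc2)) as E3.
apply locally_singleton in Hloc, Hloc2.
assert (E2 : g2 u = 0).
{ apply Rmult_eq_reg_l with (g1 u); [| now apply g1_neq0].
  rewrite <- (f1_f2 u Hu), Hloc; ring. }
unfold meridian_trace1; rewrite Hloc, E2, E3; field; now apply (me_f_neq0 ME).
Qed.

(** Let K = B^2 - 4 p^2 for B the trace, so that f1 K = 0.  Near a point where K <> 0 one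
    has f1 = 0, hence B' = 0 there.  So K K' = 0 everywhere and K^2 is constant: either
    K never vanishes, which settles the matter, or K = 0 identically, in which case
    B B' = 0 with B^2 = 4 p^2 <> 0. *)
Lemma first_integral_meridian_trace1 (p q : R) :
  p <> 0 ->
  (forall u, I u -> (f u * g1 u) * (f u * g1 u) = (q + p * (f u * f u)) * (q + p * (f u * f u))) ->
  forall u, I u -> meridian_trace1 u = 0.
Proof.
intros Hp HP.
pose (K := fun u => meridian_trace u * meridian_trace u - 4 * (p * p)).
assert (HfK : forall u, I u -> f1 u * K u = 0) by now apply (first_integral_meridian_trace_sqr p q).
assert (HK : forall u, I u -> is_derive K u (2 * meridian_trace u * meridian_trace1 u)).
{ intros u Hu; pose proof (is_derive_meridian_trace u Hu); unfold K.
  eapply is_derive_eq; [derive_by_rules | unfold minus, plus, opp, zero; simpl; ring]. }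
assert (Hopen : forall u, I u -> K u <> 0 -> meridian_trace1 u = 0).
{ intros u Hu HKu; apply meridian_trace1_eq_0_of_f1_locally_0; [exact Hu |].
  assert (Hloc : locally u (fun y => K y <> 0)).
  { assert (HC : continuous K u) by (apply @ex_derive_continuous; eexists; now apply HK).
    exact (HC _ (open_neq 0 (K u) HKu)). }
  generalize (filter_and _ _ Hloc (HI u Hu)); apply filter_imp; intros y [Hy HyI].
  destruct (Rmult_integral _ _ (HfK y HyI)); [assumption | contradiction]. }
intros u Hu; destruct (Req_dec (K u) 0) as [HKu | HKu]; [| now apply Hopen].
assert (HK0 : forall y, I y -> K y = 0).
{ intros y Hy; cut (K y * K y = K u * K u).
  { rewrite HKu; intros H; apply Rsqr_0_uniq; unfold Rsqr; rewrite H; ring. }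
  apply (constant_of_derive_0 I (fun w => K w * K w)); try assumption; [exact (me_interval ME) |].
  intros w Hw; pose proof (HK w Hw).
  eapply is_derive_eq; [derive_by_rules |].
  destruct (Req_dec (K w) 0) as [E | E]; [rewrite E; ring | rewrite (Hopen w Hw E); ring]. }
assert (E : 2 * meridian_trace u * meridian_trace1 u = 0).
{ apply (is_derive_eq_on_open I K (fun _ => 0) u); try assumption; [now apply HK | apply @is_derive_const]. }
assert (Hb : meridian_trace u <> 0) by (intros Hb; unfold K in HKu; rewrite Hb in HKu; nra).
apply Rmult_integral in E; destruct E; [lra | assumption].
Qed.

End Meridian.

(** * The surface *)

Section Surface.
Context {eps : R} {J : R -> Prop} {kappa kappa1 : R -> R} {l t n : R -> E42} {e : E42}.
Context (MF : moving_frame eps J kappa l t n e).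
Context (Hkappa : forall v, J v -> is_derive kappa v (kappa1 v)).
Context {I : R -> Prop} {f f1 f2 f3 g g1 g2 g3 : R -> R}.
Context (ME : meridian I f f1 f2 f3 g g1 g2 g3).
Context {z : vfield}.
Context (Hz : forall u v, I u -> J v -> z u v = @frame_vec l t n e v (f u) 0 0 (g u)).

Local Notation F := (@frame_vec l t n e).
Local Notation B := (@meridian_trace f f1 f2 g1 g2).
Local Notation B1 := (@meridian_trace1 f f1 f3 g1 g2 g3).

Let HI : open I := proj1 (me_interval ME).

Lemma z_u_frame u v : I u -> J v -> d_u z u v = F v (f1 u) 0 0 (g1 u).
Proof.
revert u v; apply (d_u_frame_vec I z (fun u _ => f u) (fun _ _ => 0) (fun _ _ => 0) (fun u _ => g u)
  (fun u _ => f1 u) (fun _ _ => 0) (fun _ _ => 0) (fun u _ => g1 u) HI Hz).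
intros u v Hu Hv; pose proof (me_f ME u Hu); pose proof (me_g ME u Hu).
refine (conj _ (conj _ (conj _ _))); derive_by_rules.
Qed.

Lemma z_v_frame u v : I u -> J v -> d_v z u v = F v 0 (f u) 0 0.
Proof.
intros Hu Hv.
rewrite (d_v_frame_vec MF I z (fun u _ => f u) (fun _ _ => 0) (fun _ _ => 0) (fun u _ => g u)
  (fun _ _ => 0) (fun _ _ => 0) (fun _ _ => 0) (fun _ _ => 0) Hz); try assumption.
- apply frame_vec_eq; ring.
- intros; refine (conj _ (conj _ (conj _ _))); derive_by_rules.
Qed.

Lemma z_uu_frame u v : I u -> J v -> d_u (d_u z) u v = F v (f2 u) 0 0 (g2 u).
Proof.
revert u v; apply (d_u_frame_vec I _ (fun u _ => f1 u) (fun _ _ => 0) (fun _ _ => 0) (fun u _ => g1 u)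
  (fun u _ => f2 u) (fun _ _ => 0) (fun _ _ => 0) (fun u _ => g2 u) HI z_u_frame).
intros u v Hu Hv; pose proof (me_f1 ME u Hu); pose proof (me_g1 ME u Hu).
refine (conj _ (conj _ (conj _ _))); derive_by_rules.
Qed.

Lemma z_uv_frame u v : I u -> J v -> d_u (d_v z) u v = F v 0 (f1 u) 0 0.
Proof.
revert u v; apply (d_u_frame_vec I _ (fun _ _ => 0) (fun u _ => f u) (fun _ _ => 0) (fun _ _ => 0)
  (fun _ _ => 0) (fun u _ => f1 u) (fun _ _ => 0) (fun _ _ => 0) HI z_v_frame).
intros u v Hu Hv; pose proof (me_f ME u Hu).
refine (conj _ (conj _ (conj _ _))); derive_by_rules.
Qed.

Lemma z_vv_frame u v : I u -> J v ->
  d_v (d_v z) u v = F v (- f u) 0 (- eps * kappa v * f u) 0.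
Proof.
intros Hu Hv.
rewrite (d_v_frame_vec MF I _ (fun _ _ => 0) (fun u _ => f u) (fun _ _ => 0) (fun _ _ => 0)
  (fun _ _ => 0) (fun _ _ => 0) (fun _ _ => 0) (fun _ _ => 0) z_v_frame); try assumption.
- apply frame_vec_eq; ring.
- intros; refine (conj _ (conj _ (conj _ _))); derive_by_rules.
Qed.

Lemma coefE_meridian u v : I u -> J v -> coefE z u v = - eps.
Proof.
intros Hu Hv; unfold coefE; rewrite z_u_frame, (inner_frame_vec MF) by assumption.
generalize (g1_sqr ME u Hu); intros H; transitivity (eps * (f1 u * f1 u - g1 u * g1 u)); [ring |].
rewrite H; ring.
Qed.

Lemma coefF_meridian u v : I u -> J v -> coefF z u v = 0.
Proof.
intros Hu Hv; unfold coefF; rewrite z_u_frame, z_v_frame, (inner_frame_vec MF) by assumption; ring.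
Qed.

Lemma coefG_meridian u v : I u -> J v -> coefG z u v = eps * (f u * f u).
Proof.
intros Hu Hv; unfold coefG; rewrite z_v_frame, (inner_frame_vec MF) by assumption; ring.
Qed.

Lemma metric_det_meridian u v : I u -> J v -> metric_det z u v = - (f u * f u).
Proof.
intros Hu Hv; unfold metric_det.
rewrite coefE_meridian, coefF_meridian, coefG_meridian by assumption.
transitivity (- (eps * eps) * (f u * f u)); [ring | rewrite (eps_sqr MF); ring].
Qed.

(** At each point z_v is t up to a factor, and z_u = f' l + g' e has square - eps. *)
Lemma tangential_frame (W : vfield) u v a b c d : I u -> J v -> W u v = F v a b c d ->
  tangential z W u v = F v ((d * g1 u - a * f1 u) * f1 u) b 0 ((d * g1 u - a * f1 u) * g1 u).
Proof.
intros Hu Hv HW; unfold tangential.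
rewrite HW, coefE_meridian, coefF_meridian, coefG_meridian, metric_det_meridian, z_u_frame, z_v_frame,
  !(inner_frame_vec MF), !frame_vec_scal, frame_vec_add by assumption.
pose proof (me_f_neq0 ME u Hu) as Hf; pose proof (eps_sqr MF) as He.
apply frame_vec_eq.
- transitivity (eps * eps * ((d * g1 u - a * f1 u) * f1 u)); [field; exact Hf | rewrite He; ring].
- transitivity (eps * eps * b); [field; exact Hf | rewrite He; ring].
- ring.
- transitivity (eps * eps * ((d * g1 u - a * f1 u) * g1 u)); [field; exact Hf | rewrite He; ring].
Qed.

(** The result is a combination of n and n2 = g' l + f' e, with <n2,n2> = eps and n2
    orthogonal to z_u. *)
Lemma normal_part_frame (W : vfield) u v a b c d : I u -> J v -> W u v = F v a b c d ->
  normal_part z W u v = F v ((a * g1 u - d * f1 u) * g1 u) 0 c ((a * g1 u - d * f1 u) * f1 u).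
Proof.
intros Hu Hv HW; unfold normal_part.
rewrite (tangential_frame W u v a b c d Hu Hv HW), HW, frame_vec_sub.
generalize (g1_sqr ME u Hu); intros Hg; apply frame_vec_eq; try ring.
- transitivity (a * (g1 u * g1 u) - d * f1 u * g1 u); [rewrite Hg |]; ring.
- transitivity (d - d * (g1 u * g1 u) + a * f1 u * g1 u); [| rewrite Hg]; ring.
Qed.

Lemma mean_curvature_frame u v : I u -> J v ->
  mean_curvature z u v =
  F v (- (eps / 2) * B u * g1 u) 0 (- kappa v / (2 * f u)) (- (eps / 2) * B u * f1 u).
Proof.
intros Hu Hv; unfold mean_curvature, h_uu, h_uv, h_vv.
rewrite coefE_meridian, coefF_meridian, coefG_meridian, metric_det_meridian by assumption.
rewrite (normal_part_frame _ u v _ _ _ _ Hu Hv (z_uu_frame u v Hu Hv)),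
  (normal_part_frame _ u v _ _ _ _ Hu Hv (z_uv_frame u v Hu Hv)),
  (normal_part_frame _ u v _ _ _ _ Hu Hv (z_vv_frame u v Hu Hv)), !frame_vec_scal, frame_vec_sub, frame_vec_add, frame_vec_scal.
pose proof (me_f_neq0 ME u Hu) as Hf; pose proof (eps_sqr MF) as He; unfold meridian_trace.
apply frame_vec_eq; try (field; exact Hf).
transitivity (- (eps * eps) * kappa v / (2 * f u)); [field; exact Hf | rewrite He; field; exact Hf].
Qed.

(** Both n and n2 are parallel in the direction u, so only the coefficients of H are
    differentiated: the derivative (f'' e + g'' l) of n2 is tangent by f' f'' = g' g''. *)
Lemma D_u_mean_curvature_frame u v : I u -> J v ->
  D_u z (mean_curvature z) u v =
  F v (- (eps / 2) * B1 u * g1 u) 0 (kappa v * f1 u / (2 * (f u * f u))) (- (eps / 2) * B1 u * f1 u).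
Proof.
intros Hu Hv; unfold D_u.
erewrite normal_part_frame; try eassumption.
2: { revert u v Hu Hv.
  apply (d_u_frame_vec I _ (fun u _ => - (eps / 2) * B u * g1 u) (fun _ _ => 0)
    (fun u v => - kappa v / (2 * f u)) (fun u _ => - (eps / 2) * B u * f1 u)
    (fun u _ => - (eps / 2) * B1 u * g1 u + - (eps / 2) * B u * g2 u) (fun _ _ => 0)
    (fun u v => kappa v * f1 u / (2 * (f u * f u)))
    (fun u _ => - (eps / 2) * B1 u * f1 u + - (eps / 2) * B u * f2 u) HI mean_curvature_frame).
  intros u v Hu Hv; pose proof (is_derive_meridian_trace ME u Hu); pose proof (me_f ME u Hu);
    pose proof (me_f1 ME u Hu); pose proof (me_g1 ME u Hu); pose proof (me_f_neq0 ME u Hu) as Hf.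
  refine (conj _ (conj _ (conj _ _)));
    (eapply is_derive_eq; [derive_by_rules; try lra | unfold plus, zero; simpl; try field; try exact Hf; lra]). }
generalize (g1_sqr ME u Hu) (f1_f2 ME u Hu); intros Hg Hfg.
assert (E : (- (eps / 2) * B1 u * g1 u + - (eps / 2) * B u * g2 u) * g1 u
  - (- (eps / 2) * B1 u * f1 u + - (eps / 2) * B u * f2 u) * f1 u = - (eps / 2) * B1 u).
{ transitivity (- (eps / 2) * B1 u * (g1 u * g1 u - f1 u * f1 u)
    - (eps / 2) * B u * (g1 u * g2 u - f1 u * f2 u)); [ring | rewrite Hg, Hfg; ring]. }
rewrite E; reflexivity.
Qed.

(** The derivatives of n and n2 in the direction v are multiples of t, hence tangent. *)
Lemma D_v_mean_curvature_frame u v : I u -> J v ->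
  D_v z (mean_curvature z) u v = F v 0 0 (- kappa1 v / (2 * f u)) 0.
Proof.
intros Hu Hv; unfold D_v.
erewrite normal_part_frame; try eassumption.
2: { revert u v Hu Hv.
  apply (d_v_frame_vec MF I _ (fun u _ => - (eps / 2) * B u * g1 u) (fun _ _ => 0)
    (fun u v => - kappa v / (2 * f u)) (fun u _ => - (eps / 2) * B u * f1 u)
    (fun _ _ => 0) (fun _ _ => 0) (fun u v => - kappa1 v / (2 * f u)) (fun _ _ => 0) mean_curvature_frame).
  intros u v Hu Hv; pose proof (Hkappa v Hv); pose proof (me_f_neq0 ME u Hu) as Hf.
  refine (conj _ (conj _ (conj _ _))); try derive_by_rules.
  apply is_derive_ext with (fun y => - / (2 * f u) * kappa y); [intros; simpl; field; exact Hf |].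
  eapply is_derive_eq; [derive_by_rules | unfold zero; simpl; field; exact Hf]. }
apply frame_vec_eq; ring.
Qed.

Lemma parallel_mean_curvature_frame :
  parallel_mean_curvature z I J <->
  forall u v, I u -> J v -> B1 u = 0 /\ kappa v * f1 u = 0 /\ kappa1 v = 0.
Proof.
split; intros H u v Hu Hv; pose proof (me_f_neq0 ME u Hu) as Hf.
- destruct (H u v Hu Hv) as [Du Dv].
  rewrite (D_u_mean_curvature_frame u v Hu Hv) in Du; rewrite (D_v_mean_curvature_frame u v Hu Hv) in Dv.
  apply (frame_vec_eq_0 MF) in Du, Dv; try assumption.
  destruct Du as (Du1 & _ & Du3 & _), Dv as (_ & _ & Dv3 & _); repeat split.
  + apply Rmult_integral in Du1; destruct Du1 as [Du1 | Du1]; [| now destruct (g1_neq0 ME u Hu)].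
    apply Rmult_integral in Du1; destruct Du1 as [Du1 | Du1]; [| assumption].
    generalize (eps_sqr MF); replace eps with 0 by lra; lra.
  + transitivity (2 * (f u * f u) * (kappa v * f1 u / (2 * (f u * f u)))); [field; exact Hf |].
    rewrite Du3; ring.
  + transitivity (- (2 * f u) * (- kappa1 v / (2 * f u))); [field; exact Hf | rewrite Dv3; ring].
- destruct (H u v Hu Hv) as (HB & Hk & Hk1); split.
  + rewrite (D_u_mean_curvature_frame u v Hu Hv), HB, Hk, <- (frame_vec_0 (l:=l) (t:=t) (n:=n) (e:=e) v).
    apply frame_vec_eq; field; exact Hf.
  + rewrite (D_v_mean_curvature_frame u v Hu Hv), Hk1, <- (frame_vec_0 (l:=l) (t:=t) (n:=n) (e:=e) v).
    apply frame_vec_eq; field; exact Hf.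
Qed.

Lemma flat_of_f1_0 : (forall u, I u -> f1 u = 0) -> flat z I J.
Proof.
intros Hf1 u v Hu Hv; unfold gauss_curvature.
assert (H0 : forall W : vfield, (forall u v, I u -> J v -> W u v = F v 0 0 0 0) ->
  forall u v, I u -> J v -> nabla_u z W u v = F v 0 0 0 0 /\ nabla_v z W u v = F v 0 0 0 0).
{ intros W HW u' v' Hu' Hv'; unfold nabla_u, nabla_v; split.
  - erewrite tangential_frame; try eassumption.
    2: { revert u' v' Hu' Hv'.
      apply (d_u_frame_vec I W (fun _ _ => 0) (fun _ _ => 0) (fun _ _ => 0) (fun _ _ => 0)
        (fun _ _ => 0) (fun _ _ => 0) (fun _ _ => 0) (fun _ _ => 0) HI HW).
      intros; refine (conj _ (conj _ (conj _ _))); derive_by_rules. }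
    apply frame_vec_eq; ring.
  - erewrite tangential_frame; try eassumption.
    2: { revert u' v' Hu' Hv'.
      apply (d_v_frame_vec MF I W (fun _ _ => 0) (fun _ _ => 0) (fun _ _ => 0) (fun _ _ => 0)
        (fun _ _ => 0) (fun _ _ => 0) (fun _ _ => 0) (fun _ _ => 0) HW).
      intros; refine (conj _ (conj _ (conj _ _))); derive_by_rules. }
    apply frame_vec_eq; ring. }
assert (Hvv : forall u v, I u -> J v -> nabla_v z (d_v z) u v = F v 0 0 0 0).
{ intros u' v' Hu' Hv'; unfold nabla_v.
  rewrite (tangential_frame _ u' v' _ _ _ _ Hu' Hv' (z_vv_frame u' v' Hu' Hv')), (Hf1 u' Hu').
  apply frame_vec_eq; ring. }
assert (Huv : forall u v, I u -> J v -> nabla_u z (d_v z) u v = F v 0 0 0 0).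
{ intros u' v' Hu' Hv'; unfold nabla_u.
  rewrite (tangential_frame _ u' v' _ _ _ _ Hu' Hv' (z_uv_frame u' v' Hu' Hv')), (Hf1 u' Hu').
  apply frame_vec_eq; ring. }
rewrite (proj1 (H0 _ Hvv u v Hu Hv)), (proj2 (H0 _ Huv u v Hu Hv)), frame_vec_sub, z_u_frame,
  (inner_frame_vec MF) by assumption.
unfold Rdiv; ring.
Qed.

Lemma inner_mean_curvature u v : I u -> J v ->
  inner (mean_curvature z u v) (mean_curvature z u v) =
  eps / 4 * (B u * B u - kappa v * kappa v / (f u * f u)).
Proof.
intros Hu Hv; rewrite mean_curvature_frame, (inner_frame_vec MF) by assumption.
pose proof (me_f_neq0 ME u Hu) as Hf.
transitivity (eps * (eps * eps / 4 * (B u * B u) * (g1 u * g1 u - f1 u * f1 u)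
  - kappa v * kappa v / (4 * (f u * f u)))); [field; exact Hf |].
rewrite (g1_sqr ME u Hu), (eps_sqr MF); field; exact Hf.
Qed.

Lemma normal_constant_of_kappa_0 :
  is_open_interval J -> (forall v, J v -> kappa v = 0) -> forall v w, J v -> J w -> n v = n w.
Proof.
intros HJ Hk v w Hv Hw.
assert (Hdn : forall s, J s -> is_vderive n s vzero).
{ intros s Hs; rewrite <- (frame_vec_0 (l:=l) (t:=t) (n:=n) (e:=e) s).
  replace (F s 0 0 0 0) with (comb (l s) (t s) (n s) e 0 (- eps * kappa s) 0 0);
    [now apply (mf_dn MF) |].
  apply frame_vec_eq; rewrite ?(Hk s Hs); ring. }
apply E42_ext;
  [apply (constant_of_derive_0 J (fun s => cmp1 (n s))) | apply (constant_of_derive_0 J (fun s => cmp2 (n s)))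
  | apply (constant_of_derive_0 J (fun s => cmp3 (n s))) | apply (constant_of_derive_0 J (fun s => cmp4 (n s)))];
  try assumption; intros s Hs; apply (Hdn s Hs).
Qed.

Lemma in_hyperplane_of_kappa_0 :
  is_open_interval J -> (forall v, J v -> kappa v = 0) -> (exists v, J v) -> in_hyperplane z I J.
Proof.
intros HJ Hk [v0 Hv0]; exists (n v0), 0; split.
- intros H; generalize (mf_nn MF v0 Hv0); rewrite H.
  replace (inner vzero vzero) with 0
    by (unfold inner, vzero, cmp1, cmp2, cmp3, cmp4, zero; simpl; unfold zero; simpl; ring).
  intros E; generalize (eps_sqr MF); replace eps with 0 by lra; lra.
- intros u v Hu Hv; rewrite (normal_constant_of_kappa_0 HJ Hk v0 v Hv0 Hv), (Hz u v Hu Hv).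
  replace (n v) with (F v 0 0 1 0)
    by (apply E42_ext; unfold frame_vec, comb, cmp1, cmp2, cmp3, cmp4; simpl; ring).
  rewrite (inner_frame_vec MF) by assumption; ring.
Qed.

(** The alternative is whether kappa vanishes identically: kappa f' = 0 forces f' = 0 as
    soon as kappa is nonzero at one point. *)
Lemma parallel_classification :
  is_open_interval J -> ~ minimal z I J -> parallel_mean_curvature z I J ->
  case_i I J f g kappa \/ case_ii I J f g kappa.
Proof.
intros HJ Hmin Hpar; rewrite parallel_mean_curvature_frame in Hpar.
destruct (classic (exists u v, I u /\ J v)) as [(u0 & v0 & Hu0 & Hv0) | Hempty].
2: { destruct Hmin; intros u v Hu Hv; destruct Hempty; now exists u, v. }
destruct (classic (exists v, J v /\ kappa v <> 0)) as [(v1 & Hv1 & Hk1) | Hk].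
- left.
  assert (Hf1 : forall u, I u -> f1 u = 0).
  { intros u Hu; destruct (Hpar u v1 Hu Hv1) as (_ & Hkf & _).
    apply Rmult_integral in Hkf; now destruct Hkf. }
  split.
  + exists (kappa v0); intros v Hv; apply (constant_of_derive_0 J kappa HJ); try assumption.
    intros w Hw; eapply is_derive_eq; [now apply Hkappa | now apply (Hpar u0 w)].
  + assert (Hg1 : forall u, I u -> g1 u = g1 u0).
    { intros u Hu; apply (constant_of_derive_0 I g1 (me_interval ME)); try assumption.
      intros w Hw; eapply is_derive_eq; [now apply (me_g1 ME) |].
      apply Rmult_eq_reg_l with (g1 w); [| now apply (g1_neq0 ME)].
      rewrite <- (f1_f2 ME w Hw), (Hf1 w Hw); ring. }
    exists (f u0), (g u0 - g1 u0 * u0), (g1 u0); repeat split.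
    * now apply (me_f_neq0 ME).
    * generalize (g1_sqr ME u0 Hu0); rewrite (Hf1 u0 Hu0); intros H.
      assert (H' : (g1 u0 - 1) * (g1 u0 + 1) = 0) by lra.
      apply Rmult_integral in H'; destruct H'; [left | right]; lra.
    * apply (constant_of_derive_0 I f (me_interval ME)); try assumption.
      intros w Hw; rewrite <- (Hf1 w Hw); now apply (me_f ME).
    * assert (E : g u - g1 u0 * u = g u0 - g1 u0 * u0); [| lra].
      apply (constant_of_derive_0 I (fun y => g y - g1 u0 * y) (me_interval ME)); try assumption.
      intros w Hw; pose proof (me_g ME w Hw); pose proof (is_derive_id (K := R_AbsRing) w) as Hid.
      eapply is_derive_eq; [derive_by_rules |].
      unfold minus, plus, opp, zero, one; simpl; rewrite (Hg1 w Hw); ring.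
- right.
  (* The constant a of case (ii) is half the trace, and the sign s is absorbed in it. *)
  assert (Hk0 : forall v, J v -> kappa v = 0).
  { intros v Hv; apply NNPP; intros H; apply Hk; now exists v. }
  assert (HB : forall u, I u -> B u = 2 * (B u0 / 2)).
  { intros u Hu; replace (2 * (B u0 / 2)) with (B u0) by field.
    apply (constant_of_derive_0 I B (me_interval ME)); try assumption.
    intros w Hw; eapply is_derive_eq; [now apply (is_derive_meridian_trace ME) | now apply (Hpar w v0)]. }
  set (a := B u0 / 2) in *.
  destruct (meridian_trace_constant_first_integral ME a HB) as [c Hc].
  destruct (constant_sign I g1 (me_interval ME)) as [sg [Hsg Hpos]].
  { intros u Hu; apply @ex_derive_continuous; exists (g2 u); now apply (me_g1 ME). }
  { exact (g1_neq0 ME). }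
  split; [exact Hk0 |].
  assert (Hrad : forall u, I u -> radicand 1 a c (f u) = Rsqr (f u * f1 u)).
  { intros u Hu; unfold radicand, Rsqr.
    replace (c + 1 * a * f u ^ 2) with (f u * g1 u) by (rewrite (Hc u Hu); ring).
    transitivity (f u * f u * (g1 u * g1 u) - f u * f u); [ring |].
    rewrite (g1_sqr ME u Hu); ring. }
  exists a, c, 1, sg; repeat split.
  + intros Ha; apply Hmin; intros u v Hu Hv.
    rewrite (mean_curvature_frame u v Hu Hv), (HB u Hu), Ha, (Hk0 v Hv),
      <- (frame_vec_0 (l:=l) (t:=t) (n:=n) (e:=e) v).
    pose proof (me_f_neq0 ME u Hu); apply frame_vec_eq; field; assumption.
  + now left.
  + exact Hsg.
  + rewrite (Hrad u H); apply Rle_0_sqr.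
  + rename H into Hu; pose proof (me_f_neq0 ME u Hu) as Hf.
    rewrite (is_derive_unique _ _ _ (me_f ME u Hu)); unfold phi.
    rewrite (Hrad u Hu), sqrt_Rsqr_abs.
    (* The radicand is (f f')^2, so the outer sign of phi is that of f f'. *)
    destruct (Rle_dec 0 (f u * f1 u)) as [Hs | Hs].
    * exists 1; split; [now left |]; rewrite Rabs_pos_eq by assumption; field; exact Hf.
    * exists (-1); split; [now right |]; rewrite Rabs_left by lra; field; exact Hf.
  + intros u Hu.
    rewrite (is_derive_unique _ _ _ (me_f ME u Hu)), (is_derive_unique _ _ _ (me_g ME u Hu)).
    replace (f1 u ^ 2 + 1) with (Rsqr (g1 u)) by (unfold Rsqr; rewrite (g1_sqr ME u Hu); ring).
    rewrite sqrt_Rsqr_abs; specialize (Hpos u Hu).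
    destruct Hsg as [-> | ->]; [rewrite Rabs_pos_eq | rewrite Rabs_left]; lra.
Qed.

Lemma case_i_f1 : case_i I J f g kappa -> forall u, I u -> f1 u = 0.
Proof.
intros (_ & a & b & s & _ & _ & H) u Hu.
apply (is_derive_eq_on_open I f (fun _ => a) u); try assumption.
- intros y Hy; apply (H y Hy).
- now apply (me_f ME).
- apply @is_derive_const.
Qed.

Lemma kappa1_0_of_constant k : (forall v, J v -> kappa v = k) -> forall v, J v -> kappa1 v = 0.
Proof.
intros Hk v Hv; apply (is_derive_eq_on_open J kappa (fun _ => k) v); try assumption.
- exact (mf_open MF).
- now apply Hkappa.
- apply @is_derive_const.
Qed.

Lemma case_i_parallel : case_i I J f g kappa -> parallel_mean_curvature z I J.
Proof.
intros Hi; pose proof (case_i_f1 Hi) as Hf1; destruct Hi as ((k & Hk) & _).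
apply parallel_mean_curvature_frame; intros u v Hu Hv; repeat split.
- apply (meridian_trace1_eq_0_of_f1_locally_0 ME u Hu).
  generalize (HI u Hu); apply filter_imp; exact Hf1.
- rewrite (Hf1 u Hu); ring.
- now apply (kappa1_0_of_constant k).
Qed.

Lemma case_i_CMC : case_i I J f g kappa -> CMC z I J.
Proof.
intros Hi; pose proof (case_i_f1 Hi) as Hf1; destruct Hi as ((k & Hk) & a & b & s & Ha & _ & Hfg).
exists (eps / 4 * (s / a * (s / a) - k * k / (a * a))); intros u v Hu Hv.
rewrite (inner_mean_curvature u v Hu Hv), (Hk v Hv).
assert (Hf2 : f2 u = 0).
{ apply (is_derive_eq_on_open I f1 (fun _ => 0) u); try assumption;
    [now apply (me_f1 ME) | apply @is_derive_const]. }
assert (Hg1 : g1 u = s).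
{ pose proof (is_derive_id (K := R_AbsRing) u) as Hid.
  apply (is_derive_eq_on_open I g (fun y => s * y + b) u); try assumption.
  - intros y Hy; apply (Hfg y Hy).
  - now apply (me_g ME).
  - eapply is_derive_eq; [derive_by_rules |]; unfold plus, zero, one; simpl; ring. }
unfold meridian_trace; rewrite (Hf1 u Hu), Hf2, Hg1, (proj1 (Hfg u Hu)); field; exact Ha.
Qed.

Lemma case_ii_parallel : case_ii I J f g kappa -> parallel_mean_curvature z I J.
Proof.
intros (Hk & a & c & s & _ & Ha & Hs & _ & Hphi & _).
apply parallel_mean_curvature_frame; intros u v Hu Hv; repeat split.
- revert u Hu; apply (first_integral_meridian_trace1 ME (s * a) c).
  + apply Rmult_integral_contrapositive_currified; [destruct Hs; lra | exact Ha].
  + intros u Hu; destruct (Hphi u Hu) as (Hpos & s0 & Hs0 & E).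
    rewrite (is_derive_unique _ _ _ (me_f ME u Hu)) in E.
    assert (E2 : f u * f u * (f1 u * f1 u) = radicand s a c (f u)).
    { rewrite E; unfold phi.
      assert (Hs0' : s0 * s0 = 1) by (destruct Hs0 as [-> | ->]; ring).
      transitivity (s0 * s0 * (sqrt (radicand s a c (f u)) * sqrt (radicand s a c (f u))));
        [field; now apply (me_f_neq0 ME) | rewrite Hs0', (sqrt_sqrt _ Hpos); ring]. }
    transitivity (f u * f u + f u * f u * (f1 u * f1 u)).
    * transitivity (f u * f u * (g1 u * g1 u)); [ring | rewrite (g1_sqr ME u Hu); ring].
    * rewrite E2; unfold radicand; ring.
- rewrite (Hk v Hv); ring.
- now apply (kappa1_0_of_constant 0).
Qed.

End Surface.

(** * From the base curve to the moving frame *)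

Definition axis (ty : meridian_type) : E42 := match ty with Ma => e4 | Mb => e1 end.

Lemma base_space_orthogonal_axis (ty : meridian_type) (x : E42) :
  base_space ty x -> inner x (axis ty) = 0.
Proof.
destruct ty, x as [[[x1 x2] x3] x4]; unfold inner, cmp1, cmp2, cmp3, cmp4; simpl;
  unfold cmp1, cmp4; simpl; intros ->; ring.
Qed.

(** The determinant of three vectors of the base space. *)
Definition base_det (ty : meridian_type) (x y w : E42) : R :=
  match ty with
  | Ma => cmp1 x * (cmp2 y * cmp3 w - cmp3 y * cmp2 w) - cmp2 x * (cmp1 y * cmp3 w - cmp3 y * cmp1 w)
          + cmp3 x * (cmp1 y * cmp2 w - cmp2 y * cmp1 w)
  | Mb => cmp2 x * (cmp3 y * cmp4 w - cmp4 y * cmp3 w) - cmp3 x * (cmp2 y * cmp4 w - cmp4 y * cmp2 w)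
          + cmp4 x * (cmp2 y * cmp3 w - cmp3 y * cmp2 w)
  end.

(** The Gram determinant of an orthogonal triple is the squared determinant times the
    determinant of the metric on the base space. *)
Lemma gram_det (ty : meridian_type) (x y w : E42) :
  base_space ty x -> base_space ty y -> base_space ty w ->
  inner x y = 0 -> inner x w = 0 -> inner y w = 0 ->
  inner x x * inner y y * inner w w = - base_sign ty * (base_det ty x y w * base_det ty x y w).
Proof.
intros Hx Hy Hw Hxy Hxw Hyw.
transitivity (inner x x * (inner y y * inner w w - inner y w * inner y w)
  - inner x y * (inner x y * inner w w - inner y w * inner x w)
  + inner x w * (inner x y * inner y w - inner y y * inner x w)).
- rewrite Hxy, Hxw, Hyw; ring.
- clear Hxy Hxw Hyw.
  destruct ty, x as [[[x1 x2] x3] x4], y as [[[y1 y2] y3] y4], w as [[[w1 w2] w3] w4];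
  unfold base_space, base_det, base_sign, inner, cmp1, cmp2, cmp3, cmp4 in *; simpl in *; subst; ring.
Qed.

(** Cramer's rule: the minors combine the three equations into det * q_i = 0. *)
Lemma orthogonal_to_basis (ty : meridian_type) (x y w q : E42) :
  base_space ty x -> base_space ty y -> base_space ty w -> base_space ty q ->
  base_det ty x y w <> 0 ->
  inner q x = 0 -> inner q y = 0 -> inner q w = 0 -> q = vzero.
Proof.
destruct ty, x as [[[x1 x2] x3] x4], y as [[[y1 y2] y3] y4], w as [[[w1 w2] w3] w4],
  q as [[[q1 q2] q3] q4];
unfold base_space, base_det, inner, cmp1, cmp2, cmp3, cmp4; simpl; intros -> -> -> -> Hd Hx Hy Hw.
- apply E42_ext; unfold cmp1, cmp2, cmp3, cmp4; simpl; unfold zero; simpl; [| | | reflexivity];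
  (eapply Rmult_eq_reg_l; [| exact Hd]; rewrite Rmult_0_r).
  + transitivity ((y2 * w3 - y3 * w2) * (q1 * x1 + q2 * x2 - q3 * x3 - 0 * 0)
      - (x2 * w3 - x3 * w2) * (q1 * y1 + q2 * y2 - q3 * y3 - 0 * 0)
      + (x2 * y3 - x3 * y2) * (q1 * w1 + q2 * w2 - q3 * w3 - 0 * 0)); [ring | rewrite Hx, Hy, Hw; ring].
  + transitivity (- (y1 * w3 - y3 * w1) * (q1 * x1 + q2 * x2 - q3 * x3 - 0 * 0)
      + (x1 * w3 - x3 * w1) * (q1 * y1 + q2 * y2 - q3 * y3 - 0 * 0)
      - (x1 * y3 - x3 * y1) * (q1 * w1 + q2 * w2 - q3 * w3 - 0 * 0)); [ring | rewrite Hx, Hy, Hw; ring].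
  + transitivity (- (y1 * w2 - y2 * w1) * (q1 * x1 + q2 * x2 - q3 * x3 - 0 * 0)
      + (x1 * w2 - x2 * w1) * (q1 * y1 + q2 * y2 - q3 * y3 - 0 * 0)
      - (x1 * y2 - x2 * y1) * (q1 * w1 + q2 * w2 - q3 * w3 - 0 * 0)); [ring | rewrite Hx, Hy, Hw; ring].
- apply E42_ext; unfold cmp1, cmp2, cmp3, cmp4; simpl; unfold zero; simpl; [reflexivity | | |];
  (eapply Rmult_eq_reg_l; [| exact Hd]; rewrite Rmult_0_r).
  + transitivity ((y3 * w4 - y4 * w3) * (0 * 0 + q2 * x2 - q3 * x3 - q4 * x4)
      - (x3 * w4 - x4 * w3) * (0 * 0 + q2 * y2 - q3 * y3 - q4 * y4)
      + (x3 * y4 - x4 * y3) * (0 * 0 + q2 * w2 - q3 * w3 - q4 * w4)); [ring | rewrite Hx, Hy, Hw; ring].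
  + transitivity ((y2 * w4 - y4 * w2) * (0 * 0 + q2 * x2 - q3 * x3 - q4 * x4)
      - (x2 * w4 - x4 * w2) * (0 * 0 + q2 * y2 - q3 * y3 - q4 * y4)
      + (x2 * y4 - x4 * y2) * (0 * 0 + q2 * w2 - q3 * w3 - q4 * w4)); [ring | rewrite Hx, Hy, Hw; ring].
  + transitivity (- (y2 * w3 - y3 * w2) * (0 * 0 + q2 * x2 - q3 * x3 - q4 * x4)
      + (x2 * w3 - x3 * w2) * (0 * 0 + q2 * y2 - q3 * y3 - q4 * y4)
      - (x2 * y3 - x3 * y2) * (0 * 0 + q2 * w2 - q3 * w3 - q4 * w4)); [ring | rewrite Hx, Hy, Hw; ring].
Qed.

(** The sign of <w,w> is forced by the signature of the base space, through
    [gram_det]; the expansion holds since the difference of its two sides is orthogonal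
    to the three vectors. *)
Lemma orthonormal_expansion (ty : meridian_type) (x y w e p : E42) :
  base_space ty x -> base_space ty y -> base_space ty w -> base_space ty p ->
  inner x x = base_sign ty -> inner y y = base_sign ty -> is_sign (inner w w) ->
  inner x y = 0 -> inner x w = 0 -> inner y w = 0 ->
  inner w w = - base_sign ty /\
  p = comb x y w e (base_sign ty * inner p x) (base_sign ty * inner p y) (- base_sign ty * inner p w) 0.
Proof.
intros Bx By Bw Bp Hxx Hyy Hww Hxy Hxw Hyw.
pose proof (gram_det ty x y w Bx By Bw Hxy Hxw Hyw) as HG.
assert (He : base_sign ty * base_sign ty = 1) by (destruct ty; simpl; ring).
rewrite Hxx, Hyy, He in HG.
assert (Hw : inner w w = - base_sign ty).
{ pose proof (Rle_0_sqr (base_det ty x y w)) as Hd; unfold Rsqr in Hd.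
  destruct ty, Hww as [E | E]; simpl in *; rewrite E in *; lra. }
assert (Hdet : base_det ty x y w <> 0).
{ intros Hd; rewrite Hd in HG; destruct Hww; lra. }
split; [exact Hw |].
set (a := base_sign ty * inner p x); set (b := base_sign ty * inner p y);
  set (c := - base_sign ty * inner p w).
assert (Hq : forall r, inner (vsub p (comb x y w e a b c 0)) r =
  inner p r - a * inner x r - b * inner y r - c * inner w r).
{ intros r; unfold vsub, minus, comb, inner, cmp1, cmp2, cmp3, cmp4; simpl;
    unfold plus, opp; simpl; ring. }
assert (H0 : vsub p (comb x y w e a b c 0) = vzero).
{ apply (orthogonal_to_basis ty x y w); try assumption.
  - revert Bx By Bw Bp; clear; unfold vsub, minus.
    destruct ty; unfold base_space, comb, cmp1, cmp2, cmp3, cmp4; simpl; unfold plus, opp; simpl;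
      intros -> -> -> ->; ring.
  - rewrite Hq, Hxx, (inner_sym y x), (inner_sym w x), Hxy, Hxw.
    transitivity (inner p x - base_sign ty * base_sign ty * inner p x); [unfold a; ring | rewrite He; ring].
  - rewrite Hq, Hyy, (inner_sym w y), Hxy, Hyw.
    transitivity (inner p y - base_sign ty * base_sign ty * inner p y); [unfold b; ring | rewrite He; ring].
  - rewrite Hq, Hw, Hxw, Hyw.
    transitivity (inner p w - base_sign ty * base_sign ty * inner p w); [unfold c; ring | rewrite He; ring]. }
apply E42_ext.
- apply (f_equal cmp1) in H0; revert H0; unfold vsub, minus, cmp1; simpl; unfold plus, opp, zero; simpl; lra.
- apply (f_equal cmp2) in H0; revert H0; unfold vsub, minus, cmp2; simpl; unfold plus, opp, zero; simpl; lra.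
- apply (f_equal cmp3) in H0; revert H0; unfold vsub, minus, cmp3; simpl; unfold plus, opp, zero; simpl; lra.
- apply (f_equal cmp4) in H0; revert H0; unfold vsub, minus, cmp4; simpl; unfold plus, opp, zero; simpl; lra.
Qed.

Lemma base_curve_in_base_space (ty : meridian_type) (w1 w2 : R -> R) (v : R) :
  base_space ty (base_curve ty w1 w2 v).
Proof. now destruct ty. Qed.

Lemma base_curve_sqr (ty : meridian_type) (w1 w2 : R -> R) (v : R) :
  inner (base_curve ty w1 w2 v) (base_curve ty w1 w2 v) = base_sign ty.
Proof.
assert (Hh : cosh (w1 v) * cosh (w1 v) = 1 + sinh (w1 v) * sinh (w1 v)).
{ assert (Hexp : exp (w1 v) * exp (- w1 v) = 1) by (rewrite <- exp_plus, Rplus_opp_r; apply exp_0).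
  unfold cosh, sinh; lra. }
pose proof (sin2_cos2 (w2 v)) as Ht; unfold Rsqr in Ht.
destruct ty; unfold inner, cmp1, cmp2, cmp3, cmp4; simpl.
- transitivity (cosh (w1 v) * cosh (w1 v) * (sin (w2 v) * sin (w2 v) + cos (w2 v) * cos (w2 v))
    - sinh (w1 v) * sinh (w1 v)); [ring | rewrite Ht, Hh; ring].
- transitivity (sinh (w1 v) * sinh (w1 v)
    - cosh (w1 v) * cosh (w1 v) * (sin (w2 v) * sin (w2 v) + cos (w2 v) * cos (w2 v)));
    [ring | rewrite Ht, Hh; ring].
Qed.

Definition vtwice_differentiable_on (J : R -> Prop) (c : R -> E42) : Prop :=
  forall v, J v -> is_vderive c v (vDerive c v) /\ is_vderive (vDerive c) v (vDerive (vDerive c) v).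

Lemma vtwice_differentiable_of_components (J : R -> Prop) (c : R -> E42) :
  twice_differentiable_on J (fun s => cmp1 (c s)) -> twice_differentiable_on J (fun s => cmp2 (c s)) ->
  twice_differentiable_on J (fun s => cmp3 (c s)) -> twice_differentiable_on J (fun s => cmp4 (c s)) ->
  vtwice_differentiable_on J c.
Proof.
intros H1 H2 H3 H4 v Hv.
split; apply vDerive_correct; first [apply (H1 v Hv) | apply (H2 v Hv) | apply (H3 v Hv) | apply (H4 v Hv)].
Qed.

Lemma base_curve_twice_differentiable (ty : meridian_type) (J : R -> Prop) (w1 w2 : R -> R) :
  open J -> smooth_on J w1 -> smooth_on J w2 -> vtwice_differentiable_on J (base_curve ty w1 w2).
Proof.
intros HJ Hw1 Hw2.
apply smooth_twice_differentiable in Hw1, Hw2.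
assert (Hch : twice_differentiable_on J (fun v => cosh (w1 v))).
{ apply (twice_differentiable_comp J cosh sinh); try assumption; [exact is_derive_cosh |].
  intros x; eexists; apply is_derive_sinh. }
assert (Hsh : twice_differentiable_on J (fun v => sinh (w1 v))).
{ apply (twice_differentiable_comp J sinh cosh); try assumption; [exact is_derive_sinh |].
  intros x; eexists; apply is_derive_cosh. }
assert (Hc : twice_differentiable_on J (fun v => cos (w2 v))).
{ apply (twice_differentiable_comp J cos (fun x => - sin x)); try assumption;
    intros x; [apply is_derive_cos | auto_derive; exact I]. }
assert (Hs : twice_differentiable_on J (fun v => sin (w2 v))).
{ apply (twice_differentiable_comp J sin cos); try assumption;
    intros x; [apply is_derive_sin | auto_derive; exact I]. }
assert (H0 : twice_differentiable_on J (fun _ => 0)).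
{ apply (twice_differentiable_ext J _ (fun _ => 0) HJ).
  - intros; apply @is_derive_const.
  - intros; apply @ex_derive_const. }
pose proof (twice_differentiable_mult J _ _ HJ Hch Hc) as Hchc.
pose proof (twice_differentiable_mult J _ _ HJ Hch Hs) as Hchs.
destruct ty; apply vtwice_differentiable_of_components; assumption.
Qed.

Lemma vDerive_in_base_space (ty : meridian_type) (J : R -> Prop) (c : R -> E42) (v : R) :
  open J -> J v -> (forall s, J s -> base_space ty (c s)) -> base_space ty (vDerive c v).
Proof.
intros HJ Hv Hc.
destruct ty; [change (Derive (fun r => cmp4 (c r)) v = 0) | change (Derive (fun r => cmp1 (c r)) v = 0)];
(rewrite (Derive_ext_loc _ (fun _ => 0));
  [apply Derive_const | apply filter_imp with J; [exact Hc | exact (HJ v Hv)]]).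
Qed.

(** Each derivative is expanded in the frame; its coefficients come from differentiating
    the constant inner products of l, t and n. *)
Lemma base_curve_moving_frame (ty : meridian_type) (J : R -> Prop) (w1 w2 : R -> R) (n : R -> E42) :
  let l := base_curve ty w1 w2 in
  open J -> smooth_on J w1 -> smooth_on J w2 ->
  (forall v, J v -> inner (vDerive l v) (vDerive l v) = base_sign ty) ->
  frame_normal ty J l n ->
  moving_frame (base_sign ty) J (spherical_curvature l n) l (vDerive l) n (axis ty).
Proof.
intros l HJ Hw1 Hw2 Htt [(N1 & N2 & N3 & N4) Hfr].
pose proof (base_curve_twice_differentiable ty J w1 w2 HJ Hw1 Hw2) as Hl2; fold l in Hl2.
assert (Hn : forall v, J v -> is_vderive n v (vDerive n v)).
{ intros v Hv; apply vDerive_correct; [apply (N1 1%nat) | apply (N2 1%nat) | apply (N3 1%nat) | apply (N4 1%nat)];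
    exact Hv. }
assert (Bl : forall v, J v -> base_space ty (l v)) by (intros; apply base_curve_in_base_space).
assert (Bt : forall v, J v -> base_space ty (vDerive l v)) by (intros; now apply (vDerive_in_base_space ty J)).
assert (Bdt : forall v, J v -> base_space ty (vDerive (vDerive l) v))
  by (intros; now apply (vDerive_in_base_space ty J)).
assert (Bn : forall v, J v -> base_space ty (n v)) by (intros v Hv; apply (Hfr v Hv)).
assert (Bdn : forall v, J v -> base_space ty (vDerive n v)) by (intros; now apply (vDerive_in_base_space ty J)).
assert (Hll : forall v, J v -> inner (l v) (l v) = base_sign ty) by (intros; apply base_curve_sqr).
assert (Hlt : forall v, J v -> inner (l v) (vDerive l v) = 0) by (intros v Hv; apply (Hfr v Hv)).
assert (Hln : forall v, J v -> inner (l v) (n v) = 0) by (intros v Hv; apply (Hfr v Hv)).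
assert (Htn : forall v, J v -> inner (vDerive l v) (n v) = 0) by (intros v Hv; apply (Hfr v Hv)).
assert (Hs : forall v, J v -> is_sign (inner (n v) (n v))) by (intros v Hv; apply (Hfr v Hv)).
assert (Hexp : forall v p, J v -> base_space ty p -> inner (n v) (n v) = - base_sign ty /\
  p = comb (l v) (vDerive l v) (n v) (axis ty) (base_sign ty * inner p (l v))
        (base_sign ty * inner p (vDerive l v)) (- base_sign ty * inner p (n v)) 0).
{ intros v p Hv Hp; apply orthonormal_expansion; auto. }
assert (Hnn : forall v, J v -> inner (n v) (n v) = - base_sign ty).
{ intros v Hv; apply (Hexp v (n v)); auto. }
assert (Hdd : forall c d k v, (forall s, J s -> inner (c s) (d s) = k) -> J v ->
  is_vderive c v (vDerive c v) -> is_vderive d v (vDerive d v) ->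
  inner (vDerive c v) (d v) + inner (c v) (vDerive d v) = 0).
{ intros c d k v Hk Hv Hc Hd.
  apply (is_derive_eq_on_open J (fun s => inner (c s) (d s)) (fun _ => k) v); try assumption.
  - now apply is_derive_inner.
  - apply @is_derive_const. }
assert (He : base_sign ty * base_sign ty = 1) by (destruct ty; simpl; ring).
constructor; try assumption.
- destruct ty; [now left | now right].
- destruct ty; unfold inner, cmp1, cmp2, cmp3, cmp4; simpl; ring.
- intros; apply base_space_orthogonal_axis; auto.
- intros; apply base_space_orthogonal_axis; auto.
- intros; apply base_space_orthogonal_axis; auto.
- intros v Hv; apply (Hl2 v Hv).
- intros v Hv; destruct (Hl2 v Hv) as [Dl Dt].
  pose proof (Hdd _ _ _ v Hlt Hv Dl Dt) as E1; pose proof (Hdd _ _ _ v Htt Hv Dt Dt) as E2.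
  replace (comb _ _ _ _ _ _ _ _) with (vDerive (vDerive l) v); [exact Dt |].
  rewrite (proj2 (Hexp v _ Hv (Bdt v Hv))) at 1.
  rewrite Htt in E1 by assumption; rewrite (inner_sym (vDerive l v)) in E2.
  rewrite (inner_sym (l v)) in E1.
  f_equal.
  + replace (inner (vDerive (vDerive l) v) (l v)) with (- base_sign ty) by lra.
    transitivity (- (base_sign ty * base_sign ty)); [ring | rewrite He; ring].
  + replace (inner (vDerive (vDerive l) v) (vDerive l v)) with 0 by lra; ring.
- intros v Hv; destruct (Hl2 v Hv) as [Dl Dt]; pose proof (Hn v Hv) as Dn.
  pose proof (Hdd _ _ _ v Hln Hv Dl Dn) as E1; pose proof (Hdd _ _ _ v Htn Hv Dt Dn) as E2.
  pose proof (Hdd _ _ _ v Hnn Hv Dn Dn) as E3.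
  replace (comb _ _ _ _ _ _ _ _) with (vDerive n v); [exact Dn |].
  rewrite (proj2 (Hexp v _ Hv (Bdn v Hv))) at 1.
  rewrite Htn, (inner_sym (l v)) in E1 by assumption.
  fold (spherical_curvature l n v) in E2; rewrite (inner_sym (vDerive l v)) in E2.
  rewrite (inner_sym (n v)) in E3.
  f_equal.
  + replace (inner (vDerive n v) (l v)) with 0 by lra; ring.
  + replace (inner (vDerive n v) (vDerive l v)) with (- spherical_curvature l n v) by lra; ring.
  + replace (inner (vDerive n v) (n v)) with 0 by lra; ring.
Qed.

(** Since <t,n> = 0, one has kappa = <t',n> = - <t,n'>, which involves only first
    derivatives of t and n'; this avoids a third derivative of l. *)
Lemma kappa_differentiable {eps J kappa l t n e} :
  moving_frame eps J kappa l t n e -> vsmooth_on J n ->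
  forall v, J v -> is_derive kappa v (Derive kappa v).
Proof.
intros MF (N1 & N2 & N3 & N4) v Hv; apply Derive_correct.
assert (Dn : is_vderive (vDerive n) v (vDerive (vDerive n) v)).
{ apply vDerive_correct; [apply (N1 2%nat) | apply (N2 2%nat) | apply (N3 2%nat) | apply (N4 2%nat)]; exact Hv. }
apply ex_derive_ext_loc with (fun s => - inner (vDerive n s) (t s)).
- generalize (mf_open MF v Hv); apply filter_imp; intros s Hs.
  assert (Ht : t s = @frame_vec l t n e s 0 1 0 0)
    by (apply E42_ext; unfold frame_vec, comb, cmp1, cmp2, cmp3, cmp4; simpl; ring).
  assert (Hns : vDerive n s = @frame_vec l t n e s 0 (- eps * kappa s) 0 0)
    by exact (is_vderive_unique _ _ _ (mf_dn MF s Hs)).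
  rewrite Hns, Ht, (inner_frame_vec MF) by assumption.
  apply (@eq_trans R _ (eps * eps * kappa s)); [ring | rewrite (eps_sqr MF); ring].
- apply (@ex_derive_opp R_AbsRing R_NormedModule); eexists; apply is_derive_inner; [exact Dn | apply (mf_dt MF v Hv)].
Qed.

Lemma smooth_meridian (I : R -> Prop) (f g : R -> R) :
  is_open_interval I -> smooth_on I f -> smooth_on I g -> (forall u, I u -> f u <> 0) ->
  (forall u, I u -> Derive f u ^ 2 - Derive g u ^ 2 = -1) ->
  meridian I f (Derive f) (Derive_n f 2) (Derive_n f 3) g (Derive g) (Derive_n g 2) (Derive_n g 3).
Proof.
intros HI Hf Hg Hf0 Hfg; constructor; try assumption; intros u Hu; apply Derive_correct;
  first [apply (Hf 1%nat u Hu) | apply (Hf 2%nat u Hu) | apply (Hf 3%nat u Hu)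
        | apply (Hg 1%nat u Hu) | apply (Hg 2%nat u Hu) | apply (Hg 3%nat u Hu)].
Qed.

Lemma meridian_surface_frame (ty : meridian_type) (f g : R -> R) (l t n : R -> E42) (u v : R) :
  meridian_surface ty f g l u v = comb (l v) (t v) (n v) (axis ty) (f u) 0 0 (g u).
Proof.
apply E42_ext; destruct ty; unfold comb, cmp1, cmp2, cmp3, cmp4; simpl;
  unfold plus, scal; simpl; unfold mult; simpl; ring.
Qed.

Theorem theorem4p1 :
  forall (ty : meridian_type) (I J : R -> Prop) (f g w1 w2 : R -> R) (n : R -> E42),
  let l := base_curve ty w1 w2 in
  let z := meridian_surface ty f g l in
  let kappa := spherical_curvature l n in
  is_open_interval I -> is_open_interval J ->
  smooth_on I f -> smooth_on I g ->
  smooth_on J w1 -> smooth_on J w2 ->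
  (forall u, I u -> f u <> 0) ->
  (forall u, I u -> Derive f u ^ 2 - Derive g u ^ 2 = -1) ->
  (forall v, J v -> inner (vDerive l v) (vDerive l v) = base_sign ty) ->
  frame_normal ty J l n ->
  ~ minimal z I J ->
  (parallel_mean_curvature z I J <->
     case_i I J f g kappa \/ case_ii I J f g kappa) /\
  (case_i I J f g kappa -> flat z I J /\ CMC z I J) /\
  (case_ii I J f g kappa -> in_hyperplane z I J).
Proof.
intros ty I J f g w1 w2 n l z kappa HI HJ Hf Hg Hw1 Hw2 Hf0 Hfg Htt Hn Hmin.
pose proof (base_curve_moving_frame ty J w1 w2 n (proj1 HJ) Hw1 Hw2 Htt Hn) as MF.
pose proof (kappa_differentiable MF (proj1 Hn)) as Hk.
pose proof (smooth_meridian I f g HI Hf Hg Hf0 Hfg) as ME.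
assert (Hz : forall u v, I u -> J v -> z u v = @frame_vec l (vDerive l) n (axis ty) v (f u) 0 0 (g u))
  by (intros; apply meridian_surface_frame).
split; [split | split].
- exact (parallel_classification MF Hk ME Hz HJ Hmin).
- intros [Hi | Hii].
  + exact (case_i_parallel MF Hk ME Hz Hi).
  + exact (case_ii_parallel MF Hk ME Hz Hii).
- intros Hi; split.
  + exact (flat_of_f1_0 MF ME Hz (case_i_f1 ME Hi)).
  + exact (case_i_CMC MF ME Hz Hi).
- intros Hii; apply (in_hyperplane_of_kappa_0 MF Hz HJ); [exact (proj1 Hii) |].
  apply NNPP; intros Hempty; apply Hmin; intros u v _ Hv; destruct Hempty; now exists v.
Qed.
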